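(* Let $(\mathcal{A},m)$ be a multiarrangement in an $\ell$-dimensional vector space over a field $\mathbb{K}$ such that $\mathcal{A}$ is supersolvable with a filtration $\mathcal{A}=\mathcal{A}_r\supset\mathcal{A}_{r-1}\supset\cdots\supset\mathcal{A}_2\supset\mathcal{A}_1$ and $r\ge2$. Let $m_i$ denote the multiplicity $m|_{\mathcal{A}_i}$ and let $\exp(\mathcal{A}_2,m_2)=(d_1,d_2,0,\ldots,0)$. Assume that for each $d\in\{3,\ldots,r\}$, each $H'\in\mathcal{A}_d\setminus\mathcal{A}_{d-1}$ and each $H''\in\mathcal{A}_{d-1}$, writing $X:=H'\cap H''$, it holds that $$\mathcal{A}_X=\{H',H''\}$$ or that $$m(H'')\ \ge\ \Big(\sum_{H\in\mathcal{A}_d\setminus\mathcal{A}_{d-1},\ X\subset H}m(H)\Big)-1.$$ Then $(\mathcal{A},m)$ is inductively free with $$\exp(\mathcal{A},m)=(d_1,d_2,|m_3|-|m_2|,\ldots,|m_r|-|m_{r-1}|,0,\ldots,0).$$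
   Context: Let $\mathbb{K}$ be a field, $V$ an $\ell$-dimensional $\mathbb{K}$-vector space, $S=\mathrm{Sym}(V^* )\cong\mathbb{K}[x_1,\ldots,x_\ell]$, and $\mathrm{Der}_{\mathbb{K}}(S)=\bigoplus_i S\,\partial_{x_i}$ the $S$-module of $\mathbb{K}$-linear derivations of $S$. An arrangement is a finite set $\mathcal{A}$ of hyperplanes of $V$, all containing the origin; for each $H\in\mathcal{A}$ fix a linear form $\alpha_H$ with $H=\ker\alpha_H$; $\mathrm{rank}(\mathcal{A})=\mathrm{codim}_V\bigcap_{H\in\mathcal{A}}H$. A multiarrangement $(\mathcal{A},m)$ is an arrangement with a multiplicity $m:\mathcal{A}\to\mathbb{Z}_{>0}$; $|m|=\sum_{H\in\mathcal{A}}m(H)$. Define $D(\mathcal{A},m)=\{\theta\in\mathrm{Der}_{\mathbb{K}}(S)\mid\theta(\alpha_H)\in\alpha_H^{m(H)}S\text{ for all }H\in\mathcal{A}\}$; $(\mathcal{A},m)$ is free if $D(\mathcal{A},m)$ is a free $S$-module. A nonzero derivation $\theta=\sum f_i\partial_{x_i}$ is homogeneous of degree $p$ if each $f_i$ is zero or homogeneous of degree $p$. If $(\mathcal{A},m)$ is free, $\exp(\mathcal{A},m)$ is the multiset of degrees of a homogeneous basis of $D(\mathcal{A},m)$. Every multiarrangement of rank at most 2 is free. For a subspace $X$, $\mathcal{A}_X=\{H\in\mathcal{A}\mid X\subset H\}$. Supersolvable: $\mathcal{A}$ is supersolvable if there is a filtration $\mathcal{A}=\mathcal{A}_r\supset\mathcal{A}_{r-1}\supset\cdots\supset\mathcal{A}_1$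 such that (1) $\mathrm{rank}(\mathcal{A}_i)=i$ for $i=1,\ldots,r$; (2) for any $i\in\{2,\ldots,r\}$ and distinct $H,H'\in\mathcal{A}_i$ there is $H''\in\mathcal{A}_{i-1}$ with $H\cap H'\subset H''$. Triple with respect to $H_0\in\mathcal{A}$, with $\alpha_0=\alpha_{H_0}$: Deletion $(\mathcal{A}',m')$: if $m(H_0)=1$, then $\mathcal{A}'=\mathcal{A}\setminus\{H_0\}$ and $m'=m|_{\mathcal{A}'}$; if $m(H_0)\ge2$, then $\mathcal{A}'=\mathcal{A}$, $m'(H)=m(H)$ for $H\ne H_0$, and $m'(H_0)=m(H_0)-1$. Restriction $(\mathcal{A}'',m^* )$: $\mathcal{A}''=\{H_0\cap K\mid K\in\mathcal{A}\setminus\{H_0\}\}$, an arrangement in the vector space $H_0$ (when $\ell=1$ it is the empty arrangement in the zero space), and $m^*$ is the Euler multiplicity: for $X\in\mathcal{A}''$ put $m_X=m|_{\mathcal{A}_X}$ and choose coordinates so that $X=\{x_1=x_2=0\}$; then $D(\mathcal{A}_X,m_X)$ has a homogeneous basis $\theta_X,\psi_X,\partial_{x_3},\ldots,\partial_{x_\ell}$ with $\theta_X\notin\alpha_0\mathrm{Der}_{\mathbb{K}}(S)$ and $\psi_X\in\alpha_0\mathrm{Der}_{\mathbb{K}}(S)$, and $m^*(X):=\deg\theta_X$. Inductively free: the class $\mathcal{IFM}$ of inductively free multiarrangements is the smallest class of multiarrangements such that (1) the empty arrangement $\emptyset_\ell$ in an $\ell$-dimensional vector space is in $\mathcal{IFM}$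 for every $\ell\ge0$; (2) if for $(\mathcal{A},m)$ there is $H\in\mathcal{A}$ such that, for the triple with respect to $H$, $(\mathcal{A}',m')\in\mathcal{IFM}$, $(\mathcal{A}'',m^* )\in\mathcal{IFM}$ and $\exp(\mathcal{A}',m')\supset\exp(\mathcal{A}'',m^* )$ (as multisets), then $(\mathcal{A},m)\in\mathcal{IFM}$. Members of $\mathcal{IFM}$ are free, so their exponents are defined. *)

(* Defs.v *)
From mathcomp Require Import all_boot all_algebra.
From mathcomp Require Import finmap.
From mathcomp Require Import mpoly.

Set Implicit Arguments.
Unset Strict Implicit.
Unset Printing Implicit Defensive.

Import GRing.Theory.
Local Open Scope ring_scope.
Local Open Scope fset_scope.

Section Derivations.

Variables (K : fieldType) (V : vectType K).
Implicit Types (H X : {vspace V}) (A : {fset {vspace V}}).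
Implicit Types (m : {vspace V} -> nat).

(* The coordinates x_i on V are the ones dual to [vbasis {:V}]; they identify
   Sym(V^* ) with polynomials in \dim {:V} variables. *)
Definition symalg := {mpoly K[\dim {:V}]}.

(* The row vector (f_i)_i stands for the derivation \sum_i f_i d/dx_i. *)
Definition Der := 'rV[{mpoly K[\dim {:V}]}]_(\dim {:V}).

Definition der_app (theta : Der) (p : symalg) : symalg :=
  \sum_(i < \dim {:V}) theta 0 i * p^`M(i).

(* The constant derivation in the direction v; if v is the j-th vector of a
   basis with dual coordinates y_1, ..., y_l, this is d/dy_j. *)
Definition const_der (v : V) : Der :=
  \row_i (coord (vbasis {:V}) i v)%:MP.

Definition linform_poly (a : 'Hom(V, K^o)) : symalg :=
  \sum_(i < \dim {:V}) (a (vbasis {:V})`_i : K) *: 'X_i.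

Definition hyperplane H : Prop := (\dim H).+1 = \dim {:V}.

(* The coordinate, along a vector spanning a complement of H, of the projection
   parallel to H. *)
Definition alpha_form H : 'Hom(V, K^o) :=
  (linfun (coord [tuple vpick H^C] ord0 : V -> K^o) \o (\1 - projv H))%VF.

Lemma lker_alpha_form H : hyperplane H -> lker (alpha_form H) = H.
Proof.
move=> hH.
have dC : \dim H^C%VS = 1%N by rewrite dimv_compl -hH subSnn.
have nz : vpick H^C%VS != 0.
  by rewrite vpick0; apply/eqP=> C0; move: dC; rewrite C0 dimv0.
have C1 : <[vpick H^C%VS]>%VS = H^C%VS.
  apply/eqP; rewrite eqEdim -memvE memv_pick dC dim_vline nz //.
apply/vspaceP=> v; rewrite memv_ker /alpha_form comp_lfunE !lfunE /= !lfunE /=.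
apply/eqP/idP=> [c0|vH]; last by rewrite projv_id // subrr linear0.
have wC : v - projv H v \in <<[tuple vpick H^C%VS]>>%VS.
  by rewrite span_seq1 C1 memv_projC.
have := coord_span wC; rewrite big_ord1 c0 scale0r => /eqP.
by rewrite subr_eq0 => /eqP ->; apply: memv_proj.
Qed.

Definition alpha H : symalg := linform_poly (alpha_form H).

(* The elements of {vspace V} other than the members of A play no role in the
   values of a multiplicity m on A. *)
Definition multiarrangement A m : Prop :=
  forall H, H \in A -> hyperplane H /\ (0 < m H)%N.

Definition in_D A m (theta : Der) : Prop :=
  forall H, H \in A -> exists g : symalg, der_app theta (alpha H) = alpha H ^+ m H * g.

Definition homogeneous_der (p : nat) (theta : Der) : Prop :=
  theta != 0 /\ forall i, theta 0 i \is p.-homog.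

Definition is_basis (k : nat) (b : 'I_k -> Der) (D : Der -> Prop) : Prop :=
  [/\ forall i, D (b i),
      forall theta, D theta ->
        exists c : 'I_k -> symalg, theta = \sum_i c i *: b i
    & forall c : 'I_k -> symalg, \sum_i c i *: b i = 0 -> forall i, c i = 0].

(* [has_exp A m e] says that D(A, m) is free and that the multiset of degrees
   of a homogeneous basis is e; the order of the entries of e is immaterial. *)
Definition has_exp A m (e : seq nat) : Prop :=
  exists b : 'I_(size e) -> Der,
    is_basis b (in_D A m) /\ forall i : 'I_(size e), homogeneous_der (nth 0%N e i) (b i).

Definition arr_rank A : nat := (\dim {:V} - \dim (\bigcap_(H <- A) H)%VS)%N.

Definition localization A X : {fset {vspace V}} :=
  [fset H in A | (X <= H)%VS].

Definition mult_size A m : nat := (\sum_(H <- A) m H)%N.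

Definition supersolvable_filtration A (r : nat) (F : nat -> {fset {vspace V}})
    : Prop :=
  [/\ F r = A,
      forall i, (2 <= i <= r)%N -> F i.-1 `<=` F i,
      forall i, (1 <= i <= r)%N -> arr_rank (F i) = i
    & forall i, (2 <= i <= r)%N -> forall H H', H \in F i -> H' \in F i ->
        H != H' -> exists2 H'', H'' \in F i.-1 & (H :&: H' <= H'')%VS].

Definition deletion_arr A m H0 : {fset {vspace V}} :=
  if m H0 == 1%N then A `\ H0 else A.

Definition deletion_mult m H0 : {vspace V} -> nat :=
  fun H => if H == H0 then (m H0).-1 else m H.

Definition in_alphaDer H0 (theta : Der) : Prop :=
  exists eta : Der, theta = alpha H0 *: eta.

End Derivations.

Section Restriction.

Variables (K : fieldType) (V : vectType K) (H0 : {vspace V}).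

Definition incl : 'Hom(subvs_of H0, V) := linfun (@vsval K V H0).

(* H0 :&: U as a subspace of the vector space H0. *)
Definition trace_on (U : {vspace V}) : {vspace (subvs_of H0)} :=
  (incl @^-1: U)%VS.

Definition restriction_arr (A : {fset {vspace V}})
    : {fset {vspace (subvs_of H0)}} :=
  [fset trace_on U | U in A `\ H0].

(* If x_1, ..., x_l are coordinates with X = {x_1 = x_2 = 0}, then
   d/dx_3, ..., d/dx_l are the constant derivations along a basis of X. *)
Definition euler_mult (A : {fset {vspace V}}) (m : {vspace V} -> nat)
    (X : {vspace (subvs_of H0)}) (d : nat) : Prop :=
  let XV := (incl @: X)%VS in
  exists (theta psi : Der V) (p : nat) (e : seq V),
    let b := [:: theta, psi & [seq const_der v | v <- e]] in
    [/\ basis_of XV e,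
        is_basis (fun i : 'I_(size b) => nth 0 b i)
                 (in_D (localization A XV) m),
        homogeneous_der d theta /\ homogeneous_der p psi,
        ~ in_alphaDer H0 theta
      & in_alphaDer H0 psi].

End Restriction.

(* The restriction lives in the vector space [subvs_of H0], so V varies in the
   induction.  Since the Euler multiplicity is unique, the constructor takes a
   function mstar that agrees with it on the restricted arrangement. *)
Inductive IFM (K : fieldType) :
    forall V : vectType K, {fset {vspace V}} -> ({vspace V} -> nat) -> Prop :=
| IFM_empty (V : vectType K) (m : {vspace V} -> nat) : IFM fset0 m
| IFM_step (V : vectType K) (A : {fset {vspace V}}) (m : {vspace V} -> nat)
    (H0 : {vspace V}) (mstar : {vspace (subvs_of H0)} -> nat)
    (e' e'' : seq nat) :
    multiarrangement A m ->
    H0 \in A ->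
    (forall X, X \in restriction_arr H0 A -> euler_mult A m X (mstar X)) ->
    IFM (deletion_arr A m H0) (deletion_mult m H0) ->
    IFM (restriction_arr H0 A) mstar ->
    has_exp (deletion_arr A m H0) (deletion_mult m H0) e' ->
    has_exp (restriction_arr H0 A) mstar e'' ->
    (forall d, (count_mem d e'' <= count_mem d e')%N) ->
    IFM A m.

(* Main.v *)
(** Let B = A_(r-1), C = A \ B, and choose v lying in every hyperplane of B and in no
    hyperplane of C.  For H in C let beta_H be the equation of H with beta_H(v) = 1; for two
    such hyperplanes beta_H - beta_H' is a multiple of the equation of some H'' in B.  The
    bound on m(H'') is what makes the Hermite interpolation problem
    f = - theta(beta_H) mod beta_H^m(H) solvable for every theta in D(B, m): one hyperplane and
    one multiplicity at a time, the obstruction is a divisibility that can be tested one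
    class H0 /\ H'' at a time, where it follows from the solution of degree m(H'') of a
    one-variable interpolation problem.  So each theta lifts to a derivation
    theta + f d/dv of (A, m), and these lifts together with (prod beta_H^m(H)) d/dv form a
    basis.  The same one-variable solution computes the Euler multiplicity
    m*(H0 /\ H'') = m(H''), so the restriction to H0 in C is again supersolvable, of rank
    r - 1, with exponents those of (B, m) with one zero removed.  In rank two the exponents of
    the deletion and of the restriction are read off a basis of the deletion by
    eliminating, modulo the equation of H0, the derivation of higher degree by that of
    lower degree. *)

From HB Require Import structures.
Require Import Defs.
From mathcomp Require Import all_boot all_algebra.
From mathcomp Require Import finmap.
From mathcomp Require Import ring zify.
From mathcomp Require Import mpoly.
Local Open Scope fset_scope.

Set Implicit Arguments.
Unset Strict Implicit.
Unset Printing Implicit Defensive.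

Import GRing.Theory.
Local Open Scope ring_scope.

(** * Divisibility and linear substitutions *)

(** Since d/dv kills every equation of B, adding f d/dv to a derivation leaves its conditions along
    B alone and changes its values on all beta_H, H in C, by the same f. So a single polynomial f
    has to meet all the congruences at once. The hyperplanes of C through one X = H0 /\ H'' have
    their equations in the pencil spanned by beta_H0 and the equation of H'', and a binary form of
    degree m(H'') has m(H'') + 1 coefficients: this is the origin of the -1 in the bound. If H0 is
    the only member of C through X, the local problem is solved by f = 0. Inductive freeness asks
    for the restriction at every deletion step. Here H0 is a complement of the line of v, so each
    restriction is a copy of B modulo v, with the multiplicities of B, whatever is left of the
    multiplicities on C; this closes the induction on the rank. The rank two bottom needs another
    argument, because no bound is assumed there: the Euler multiplicity changes along the deletions
    and has to be read off degrees. *)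

Definition rdvd (R : comNzRingType) (a p : R) : Prop := exists g, p = a * g.

Section Rdvd.
Variable R : idomainType.
Implicit Types a b p q : R.

Lemma rdvd0 a : rdvd a 0.
Proof. by exists 0; rewrite mulr0. Qed.

Lemma rdvd1 p : rdvd 1 p.
Proof. by exists p; rewrite mul1r. Qed.

Lemma rdvdD a p q : rdvd a p -> rdvd a q -> rdvd a (p + q).
Proof. by move=> [g ->] [h ->]; exists (g + h); rewrite mulrDr. Qed.

Lemma rdvdN a p : rdvd a p -> rdvd a (- p).
Proof. by move=> [g ->]; exists (- g); rewrite mulrN. Qed.

Lemma rdvdB a p q : rdvd a p -> rdvd a q -> rdvd a (p - q).
Proof. by move=> ap /rdvdN; apply: rdvdD. Qed.

Lemma rdvdMl a p q : rdvd a q -> rdvd a (p * q).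
Proof. by move=> [g ->]; exists (p * g); rewrite mulrCA. Qed.

Lemma rdvdMr a p q : rdvd a p -> rdvd a (p * q).
Proof. by rewrite mulrC; apply: rdvdMl. Qed.

Lemma rdvd_refl a : rdvd a a.
Proof. by exists 1; rewrite mulr1. Qed.

Lemma rdvdM a b p q : rdvd a p -> rdvd b q -> rdvd (a * b) (p * q).
Proof. by move=> [g ->] [h ->]; exists (g * h); rewrite mulrACA. Qed.

Lemma rdvd_trans a b p : rdvd a b -> rdvd b p -> rdvd a p.
Proof. by move=> [g ->] [h ->]; exists (g * h); rewrite mulrA. Qed.

Lemma rdvd_exp a i j : (i <= j)%N -> rdvd (a ^+ i) (a ^+ j).
Proof. by move=> ij; exists (a ^+ (j - i)); rewrite -exprD subnKC. Qed.

Lemma rdvd_mulIl c a p : c != 0 -> rdvd (c * a) (c * p) -> rdvd a p.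
Proof. by move=> c0 [g]; rewrite -mulrA => /(mulfI c0) ->; exists g. Qed.

Lemma rdvd_unitl u a p : u \is a GRing.unit -> rdvd (u * a) p <-> rdvd a p.
Proof.
move=> uU; split=> [[g ->]|[g ->]].
  by exists (u * g); rewrite mulrCA mulrA.
by exists (u^-1 * g); rewrite mulrACA mulrV // mul1r.
Qed.

Definition rprime a : Prop :=
  [/\ a != 0, ~ rdvd a 1 & forall p q, rdvd a (p * q) -> rdvd a p \/ rdvd a q].

Lemma rprime_exp a p q k :
  rprime a -> ~ rdvd a p -> rdvd (a ^+ k) (p * q) -> rdvd (a ^+ k) q.
Proof.
move=> [a0 _ aP] ap; elim: k q => [|k IH] q; first by move=> _; apply: rdvd1.
rewrite exprS => H.
have [//|[g qE]] : rdvd a p \/ rdvd a q.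
  by apply: aP; apply: rdvd_trans H; apply/rdvdMr/rdvd_refl.
move: H; rewrite qE mulrCA => /(rdvd_mulIl a0) /IH H.
by apply: rdvdM; first apply: rdvd_refl.
Qed.

Lemma rprime_prod a (I : Type) (s : seq I) (E : I -> R) (P : pred I) :
  rprime a -> (forall i, P i -> ~ rdvd a (E i)) ->
  ~ rdvd a (\prod_(i <- s | P i) E i).
Proof.
move=> [a0 a1 aP] aE; elim/big_rec: _ => [//|i p Pi ap].
by case/aP => //; apply: aE.
Qed.

Lemma rprime_expn a b k : rprime a -> ~ rdvd a b -> ~ rdvd a (b ^+ k).
Proof.
move=> [a0 a1 aP] aE; elim: k => [|k IH]; rewrite ?expr0 // exprS.
by case/aP.
Qed.

(** Stands in for unique factorization: primality of the factors is enough to collect divisibilities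
    one factor at a time, and the factors will be linear forms. *)
Lemma rprime_prod_dvd (I : eqType) (s : seq I) (P : pred I) (y : I -> R)
    (n : I -> nat) g :
  uniq s -> {in s, forall i, P i -> rprime (y i)} ->
  {in s &, forall i j, P i -> P j -> i != j -> ~ rdvd (y i) (y j)} ->
  {in s, forall i, P i -> rdvd (y i ^+ n i) g} ->
  rdvd (\prod_(i <- s | P i) y i ^+ n i) g.
Proof.
elim: s => [|i s IH] /=; first by move=> *; rewrite big_nil; apply: rdvd1.
move=> /andP [is_ us] yP yN yD; rewrite big_cons.
have [k gE] : rdvd (\prod_(j <- s | P j) y j ^+ n j) g.
  apply: IH => // [j js|j k js ks|j js]; [apply: yP|apply: yN|apply: yD];
  by rewrite inE ?js ?ks orbT.
case: ifP => Pi; last by exists k.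
rewrite gE mulrC; apply: rdvdM; first apply: rdvd_refl.
have ipr := yP i (mem_head _ _) Pi.
apply: (@rprime_exp _ (\prod_(j <- s | P j) y j ^+ n j)) => //.
  rewrite big_seq_cond; apply: rprime_prod => // j /andP [js Pj].
  apply: rprime_expn => //; apply: yN; rewrite ?mem_head ?inE ?js ?orbT //.
  by apply: contraNneq is_ => ->.
by rewrite -gE; apply: yD => //; apply: mem_head.
Qed.

End Rdvd.

Section Forms.
Variables (K : fieldType) (V : vectType K).
Implicit Types (a : 'Hom(V, K^o)) (H X : {vspace V}).

Definition crd (i : 'I_(\dim {:V})) : 'Hom(V, K^o) :=
  linfun (coord (vbasis {:V}) i : V -> K^o).

Lemma crdE i v : crd i v = coord (vbasis {:V}) i v.
Proof. by rewrite lfunE. Qed.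

Lemma crd_sum (v : V) : v = \sum_i crd i v *: (vbasis {:V})`_i.
Proof.
rewrite {1}(coord_vbasis (memvf v)); apply: eq_bigr => i _.
by rewrite crdE.
Qed.

Lemma formE a v : a v = \sum_i crd i v * a (vbasis {:V})`_i.
Proof.
rewrite {1}(crd_sum v) linear_sum; apply: eq_bigr => i _.
by rewrite linearZ.
Qed.

Lemma crd_basis i (j : 'I_(\dim {:V})) : crd i (vbasis {:V})`_j = (i == j)%:R.
Proof. by rewrite crdE coord_free ?(basis_free (vbasisP _)) // eq_sym. Qed.

Lemma linform_crd i : linform_poly (crd i) = 'X_i.
Proof.
rewrite /linform_poly (bigD1 i) //= big1 => [|j ji]; rewrite crd_basis.
  by rewrite eqxx scale1r addr0.
by rewrite eq_sym (negPf ji) scale0r.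
Qed.

Fact linform_is_linear : linear (@linform_poly K V).
Proof.
move=> c a b; rewrite /linform_poly scaler_sumr -big_split.
by apply: eq_bigr => i _; rewrite /= add_lfunE scale_lfunE scalerDl scalerA.
Qed.

HB.instance Definition _ := GRing.isLinear.Build K 'Hom(V, K^o) (symalg V) _
  (@linform_poly K V) linform_is_linear.

Lemma mcoeff_linform a i : (linform_poly a)@_U_(i) = a (vbasis {:V})`_i.
Proof.
rewrite raddf_sum (bigD1 i) //= big1 => [|j ji]; rewrite mcoeffZ mcoeffX.
  by rewrite eqxx mulr1 addr0.
by rewrite eq_mnm1 (negPf ji) mulr0.
Qed.

Lemma linform_inj : injective (@linform_poly K V).
Proof.
move=> a b ab; apply/lfunP => v; rewrite !formE; apply: eq_bigr => i _.
by rewrite -!mcoeff_linform ab.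
Qed.

Lemma linform_homog a : linform_poly a \is 1.-homog.
Proof.
by apply: rpred_sum => i _; apply: rpredZ; rewrite dhomogX /= mdeg1.
Qed.

End Forms.

Section Pull.
Variable K : fieldType.

(** Composition of polynomial functions with [phi], that is, the algebra map of symmetric algebras
    dual to [phi]; [pull_linform] characterizes it without coordinates. *)
Definition pull (U V : vectType K) (phi : 'Hom(U, V)) (p : symalg V) :
    symalg U :=
  p \mPo [tuple linform_poly (crd i \o phi)%VF | i < \dim {:V}].

Section OneMap.
Variables (U V : vectType K) (phi : 'Hom(U, V)).

HB.instance Definition _ := GRing.isAdditive.Build (symalg V) (symalg U)
  (pull phi) (comp_mpoly_is_additive _).
HB.instance Definition _ := GRing.isMultiplicative.Build (symalg V) (symalg U)
  (pull phi) (comp_mpoly_is_multiplicative _).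

Lemma pullC c : pull phi c%:MP = c%:MP.
Proof. exact: comp_mpolyC. Qed.

Lemma pullZ c p : pull phi (c *: p) = c *: pull phi p.
Proof. exact: comp_mpolyZ. Qed.

Lemma pull_crd i : pull phi 'X_i = linform_poly (crd i \o phi)%VF.
Proof. by rewrite /pull comp_mpolyXU -tnth_nth tnth_mktuple. Qed.

Lemma pull_linform (a : 'Hom(V, K^o)) :
  pull phi (linform_poly a) = linform_poly (a \o phi)%VF.
Proof.
rewrite {1}/linform_poly raddf_sum /=.
under eq_bigr => i _ do rewrite pullZ pull_crd -linearZ.
rewrite -linear_sum; congr linform_poly; apply/lfunP => v.
rewrite sum_lfunE comp_lfunE [RHS]formE; apply: eq_bigr => i _.
by rewrite scale_lfunE comp_lfunE /= mulrC.
Qed.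

End OneMap.

(** Reduces identities between algebra maps to their values on linear forms, so that coordinates
    stay out of the later arguments. *)
Lemma symalg_ind (V : vectType K) (P : symalg V -> Prop) :
  (forall c, P c%:MP) -> (forall p q, P p -> P q -> P (p + q)) ->
  (forall p q, P p -> P q -> P (p * q)) -> (forall a, P (linform_poly a)) ->
  forall p, P p.
Proof.
move=> PC PD PM PL; elim/mpolyind => [|c m p _ _ IH]; first exact: (PC 0).
apply: (PD) IH; rewrite -mul_mpolyC mpolyXE_id; apply: (PM) => //.
elim/big_rec: _ => [|i q _ Pq]; first exact: (PC 1).
apply: (PM) Pq; elim: (m i) => [|k IH]; first exact: (PC 1).
by rewrite exprS; apply: (PM) => //; rewrite -linform_crd.
Qed.

Lemma pull_id (V : vectType K) (p : symalg V) : pull \1%VF p = p.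
Proof.
elim/symalg_ind: p => [c|p q|p q|a].
- by rewrite pullC.
- by rewrite raddfD /= => -> ->.
- by rewrite rmorphM /= => -> ->.
- by rewrite pull_linform comp_lfun1r.
Qed.

Lemma pull_comp (U V W : vectType K) (phi : 'Hom(U, V)) (psi : 'Hom(V, W)) p :
  pull phi (pull psi p) = pull (psi \o phi)%VF p.
Proof.
elim/symalg_ind: p => [c|p q|p q|a].
- by rewrite !pullC.
- by rewrite !raddfD /= => -> ->.
- by rewrite !rmorphM /= => -> ->.
- by rewrite !pull_linform comp_lfunA.
Qed.

Lemma pull_homog (U V : vectType K) (phi : 'Hom(U, V)) d p :
  p \is d.-homog -> pull phi p \is d.-homog.
Proof.
move=> /dhomogP hp; rewrite [p]mpolyE raddf_sum big_seq; apply: rpred_sum => m.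
move=> /hp <-; rewrite /= pullZ; apply: rpredZ; rewrite mpolyXE_id rmorph_prod /=.
rewrite mdegE; elim/big_rec2: _ => [|i q d' _ IH]; first exact: dhomog1.
apply: dhomogM IH; rewrite rmorphXn /= pull_crd -[X in X.-homog]mul1n.
by apply: dhomogMn; apply: linform_homog.
Qed.

End Pull.

(** * Derivations through their values on linear forms *)

Section DerApp.
Variables (K : fieldType) (V : vectType K).
Implicit Types (a b : 'Hom(V, K^o)) (theta eta : Der V) (v w : V).

Lemma der_app_linform theta a :
  der_app theta (linform_poly a) =
  \sum_(i < \dim {:V}) (a (vbasis {:V})`_i : K) *: theta 0 i.
Proof.
rewrite /der_app; apply: eq_bigr => i _; rewrite -mul_mpolyC mulrC.
congr (_ * _); rewrite raddf_sum (bigD1 i) //= big1 => [|j ji].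
  rewrite linearZ /= mderivX mnm1E eqxx -{1}[U_(i)%MM]add0m addmK mpolyX0.
  by rewrite scale1r addr0 alg_mpolyC.
by rewrite linearZ /= mderivX mnm1E (negPf ji) scale0r scaler0.
Qed.

Lemma der_app_crd theta i : der_app theta (linform_poly (crd i)) = theta 0 i.
Proof.
rewrite der_app_linform (bigD1 i) //= big1 => [|j ji]; rewrite crd_basis.
  by rewrite eqxx scale1r addr0.
by rewrite eq_sym (negPf ji) scale0r.
Qed.

Lemma der_app_lin theta c a b :
  der_app theta (linform_poly (c *: a + b)) =
  c *: der_app theta (linform_poly a) + der_app theta (linform_poly b).
Proof.
rewrite !der_app_linform scaler_sumr -big_split; apply: eq_bigr => i _ /=.
by rewrite add_lfunE scale_lfunE scalerDl scalerA.
Qed.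

Lemma der_appZr theta c a :
  der_app theta (linform_poly (c *: a)) = c *: der_app theta (linform_poly a).
Proof.
by rewrite !der_app_linform scaler_sumr; apply: eq_bigr => i _;
  rewrite scale_lfunE scalerA.
Qed.

Lemma der_appDr theta a b :
  der_app theta (linform_poly (a + b)) =
  der_app theta (linform_poly a) + der_app theta (linform_poly b).
Proof. by have := der_app_lin theta 1 a b; rewrite !scale1r. Qed.

Lemma der_appBr theta a b :
  der_app theta (linform_poly (a - b)) =
  der_app theta (linform_poly a) - der_app theta (linform_poly b).
Proof. by rewrite addrC -scaleN1r der_app_lin scaleN1r addrC. Qed.

Lemma der_app0 p : der_app (0 : Der V) p = 0.
Proof. by rewrite /der_app big1 // => i _; rewrite mxE mul0r. Qed.

Lemma der_appD theta eta p :
  der_app (theta + eta) p = der_app theta p + der_app eta p.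
Proof.
by rewrite /der_app -big_split; apply: eq_bigr => i _; rewrite mxE mulrDl.
Qed.

Lemma der_appZ c theta p : der_app (c *: theta) p = c * der_app theta p.
Proof.
by rewrite /der_app mulr_sumr; apply: eq_bigr => i _; rewrite mxE mulrA.
Qed.

Lemma der_appB theta eta p :
  der_app (theta - eta) p = der_app theta p - der_app eta p.
Proof. by rewrite der_appD -scaleN1r der_appZ mulN1r. Qed.

Lemma der_app_const v a : der_app (const_der v) (linform_poly a) = (a v)%:MP.
Proof.
rewrite der_app_linform formE raddf_sum; apply: eq_bigr => i _ /=.
by rewrite mxE crdE mulrC mpolyCM mul_mpolyC.
Qed.

Lemma der_eqP theta eta :
  (forall a, der_app theta (linform_poly a) = der_app eta (linform_poly a)) ->
  theta = eta.
Proof. by move=> E; apply/rowP => i; rewrite -!der_app_crd. Qed.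

Lemma der_app_homog theta d a :
  (forall i, theta 0 i \is d.-homog) -> der_app theta (linform_poly a) \is d.-homog.
Proof.
by move=> hd; rewrite der_app_linform; apply: rpred_sum => i _; apply: rpredZ.
Qed.

End DerApp.

Section DerMap.
Variables (K : fieldType) (U V : vectType K).
Variables (phi : 'Hom(U, V)) (psi : 'Hom(V, U)).

(** With [phi] the inclusion of a hyperplane and [psi] a projection onto it, this restricts a
    derivation to the hyperplane; with the two maps exchanged it extends one from the hyperplane. *)
Definition der_map (theta : Der V) : Der U :=
  \row_i pull phi (der_app theta (linform_poly (crd i \o psi)%VF)).

Lemma der_mapE theta (a : 'Hom(U, K^o)) :
  der_app (der_map theta) (linform_poly a) =
  pull phi (der_app theta (linform_poly (a \o psi)%VF)).
Proof.
rewrite [in LHS]der_app_linform.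
under eq_bigr => i _ do rewrite mxE -pullZ -der_appZr.
have -> : (a \o psi)%VF = \sum_(i < \dim {:U}) (a (vbasis {:U})`_i : K) *: (crd i \o psi)%VF.
  apply/lfunP => w; rewrite sum_lfunE comp_lfunE formE; apply: eq_bigr => i _.
  by rewrite scale_lfunE comp_lfunE mulrC.
elim/big_rec2: _ => [|i p b _ ->]; last by rewrite der_appDr raddfD.
by rewrite der_app_linform big1 ?raddf0 // => i _; rewrite zero_lfunE scale0r.
Qed.

End DerMap.

Section LinearForms.
Variables (K : fieldType) (V : vectType K).
Implicit Types (a b : 'Hom(V, K^o)) (H X : {vspace V}) (v w : V).

Definition outer_fun a v w : V := (a w : K) *: v.

Fact outer_is_linear a v : linear (outer_fun a v).
Proof. by move=> c x y; rewrite /outer_fun linearP scalerDl scalerA. Qed.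

HB.instance Definition _ a v := GRing.isLinear.Build K V V _
  (outer_fun a v) (outer_is_linear a v).

Definition outer a v : 'End(V) := linfun (outer_fun a v).

Lemma outerE a v w : outer a v w = (a w : K) *: v.
Proof. by rewrite lfunE. Qed.

(** For a(v) = 1 this is the projection onto the kernel of [a] along [v]. Then [pull (aproj a v)] is
    reduction modulo [a], realized as an idempotent endomorphism of the same polynomial ring. *)
Definition aproj a v : 'End(V) := \1%VF - outer a v.

Lemma aprojE a v w : aproj a v w = w - (a w : K) *: v.
Proof. by rewrite add_lfunE id_lfunE opp_lfunE outerE. Qed.

Lemma form_scale a (c : K) v : a (c *: v) = c * (a v : K).
Proof. by rewrite linearZ. Qed.

Lemma form_aproj b a v w : b (aproj a v w) = (b w : K) - (a w : K) * (b v : K).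
Proof. by rewrite aprojE linearB /= form_scale. Qed.

Lemma aproj_ker a v w : a v = 1 -> a (aproj a v w) = 0.
Proof. by move=> av; rewrite form_aproj av mulr1 subrr. Qed.

Lemma aproj_mod a v p : rdvd (linform_poly a) (p - pull (aproj a v) p).
Proof.
elim/symalg_ind: p => [c|p q|p q|b].
- by rewrite pullC subrr; apply: rdvd0.
- by rewrite raddfD opprD addrACA; apply: rdvdD.
- move=> hp hq; rewrite rmorphM /=.
  rewrite -[p * q - _](subrKA (p * pull (aproj a v) q)) -mulrBr -mulrBl.
  by apply: rdvdD; [apply: rdvdMl|apply: rdvdMr].
- rewrite pull_linform -linearB.
  have -> : b - (b \o aproj a v)%VF = (b v : K) *: a.
    apply/lfunP => w; rewrite add_lfunE opp_lfunE comp_lfunE form_aproj.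
    by rewrite opprB addrC subrK scale_lfunE mulrC.
  by rewrite linearZ /= -mul_mpolyC; apply/rdvdMl/rdvd_refl.
Qed.

Lemma rdvd_aproj a v p : a v = 1 ->
  rdvd (linform_poly a) p <-> pull (aproj a v) p = 0.
Proof.
move=> av; split=> [[g ->]|p0].
  rewrite rmorphM /= pull_linform.
  have -> : (a \o aproj a v)%VF = 0; last by rewrite raddf0 mul0r.
  by apply/lfunP => w; rewrite comp_lfunE zero_lfunE aproj_ker.
by have := aproj_mod a v p; rewrite p0 subr0.
Qed.

Lemma linform_eq0 a : (linform_poly a == 0) = (a == 0).
Proof. by rewrite -(raddf0 (@linform_poly K V)) (inj_eq (@linform_inj K V)). Qed.

Lemma form_neq0 a : a != 0 -> exists v, a v = 1.
Proof.
move=> a0; have [/eqP k0|] := boolP (lker a == fullv).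
  case/eqP: a0; apply/lfunP => v; rewrite zero_lfunE; apply/eqP.
  by rewrite -memv_ker k0 memvf.
rewrite eqEsubv subvf /= => /subvPn [v _]; rewrite memv_ker => av.
by exists ((a v : K)^-1 *: v); rewrite form_scale mulVf.
Qed.

(** The ideal generated by [a] is the kernel of [pull (aproj a v)], a ring morphism into a
    domain. *)
Lemma linform_prime a : a != 0 -> rprime (linform_poly a).
Proof.
move=> a0; have [v av] := form_neq0 a0; split; first by rewrite linform_eq0.
  by move=> /(rdvd_aproj _ av); rewrite rmorph1 => /eqP; rewrite oner_eq0.
move=> p q /(rdvd_aproj _ av); rewrite rmorphM => /eqP; rewrite mulf_eq0.
by case/orP => /eqP ?; [left|right]; apply/(rdvd_aproj _ av).
Qed.

Lemma lker_scale a b : (lker a <= lker b)%VS -> exists c : K, b = c *: a.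
Proof.
have [-> kab|a0 kab] := eqVneq a 0; last first.
  have [v av] := form_neq0 a0; exists (b v : K); apply/lfunP => w.
  have : aproj a v w \in lker b.
    by apply: (subvP kab); rewrite memv_ker aproj_ker.
  rewrite memv_ker form_aproj subr_eq0 => /eqP ->.
  by rewrite scale_lfunE [LHS]mulrC.
exists 0; apply/lfunP => v; rewrite scale0r zero_lfunE; apply/eqP.
rewrite -memv_ker; apply: (subvP kab).
by rewrite memv_ker zero_lfunE.
Qed.

Lemma rdvd_linform a b :
  rdvd (linform_poly a) (linform_poly b) -> (lker a <= lker b)%VS.
Proof.
have [->|a0] := eqVneq a 0.
  rewrite raddf0 => -[g /eqP]; rewrite mul0r linform_eq0 => /eqP ->.
  exact: subvv.
have [v av] := form_neq0 a0; move=> /(rdvd_aproj _ av); rewrite pull_linform.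
move=> /eqP; rewrite linform_eq0 => /eqP b0; apply/subvP => w.
rewrite !memv_ker => /eqP aw; move/lfunP: b0 => /(_ w).
by rewrite comp_lfunE aprojE aw scale0r subr0 zero_lfunE => ->.
Qed.

Lemma alpha_form_neq0 H : hyperplane H -> alpha_form H != 0.
Proof.
move=> hH; apply/eqP => a0; have := lker_alpha_form hH; rewrite a0 => kH.
move: hH; rewrite /hyperplane -kH.
have -> : lker (0 : 'Hom(V, K^o)) = fullv; last by move/eqP; rewrite eqn_leq ltnn.
apply/eqP; rewrite eqEsubv subvf /=; apply/subvP => v _.
by rewrite memv_ker zero_lfunE.
Qed.

Lemma alpha_prime H : hyperplane H -> rprime (alpha H).
Proof. by move=> hH; apply/linform_prime/alpha_form_neq0. Qed.

Lemma hyperplane_eq H H' : hyperplane H -> hyperplane H' -> (H <= H')%VS -> H = H'.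
Proof.
move=> hH hH' sHH; apply/eqP; rewrite eqEdim sHH /=.
by rewrite -ltnS hH hH'.
Qed.

Lemma alpha_ndvd H H' : hyperplane H -> hyperplane H' -> H != H' ->
  ~ rdvd (alpha H) (alpha H').
Proof.
move=> hH hH' /eqP nHH /rdvd_linform; rewrite !lker_alpha_form // => sH.
exact/nHH/hyperplane_eq.
Qed.

Lemma mpolyC_unit n (c : K) : c != 0 -> (c%:MP : {mpoly K[n]}) \is a GRing.unit.
Proof. by move=> c0; apply: rmorph_unit; rewrite unitfE. Qed.

Lemma lker_eq_scale a b : a != 0 -> lker a = lker b ->
  exists2 c : K, c != 0 & b = c *: a.
Proof.
move=> a0 kab; have [|c bE] := @lker_scale a b; first by rewrite kab.
exists c => //; apply/eqP => c0; move: kab; rewrite bE c0 scale0r => kE.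
have [v av] := form_neq0 a0; have : v \in lker a.
  by rewrite kE memv_ker zero_lfunE.
by rewrite memv_ker av oner_eq0.
Qed.

(** Two equations of H differ by a nonzero scalar, so the condition at H may be tested on any of
    them; later mostly on the one normalized at v. *)
Lemma in_D_form H a theta k : hyperplane H -> lker a = H ->
  (exists g : symalg V, der_app theta (alpha H) = alpha H ^+ k * g) <->
  rdvd (linform_poly a ^+ k) (der_app theta (linform_poly a)).
Proof.
move=> hH aH; have [||c c0 ->] := @lker_eq_scale (alpha_form H) a.
- exact: alpha_form_neq0.
- by rewrite lker_alpha_form // aH.
rewrite der_appZr linearZ /= exprZn -!mul_mpolyC.
have u1 := mpolyC_unit (\dim {:V}) (expf_neq0 k c0).
have u2 := mpolyC_unit (\dim {:V}) c0.
split => [[g E]|/(rdvd_unitl _ _ u1)].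
  by apply/(rdvd_unitl _ _ u1); apply: rdvdMl; exists g.
move=> /(rdvdMl (c^-1)%:MP); rewrite mulrA -mpolyCM mulVf // mpolyC1 mul1r.
by [].
Qed.

Lemma dvd_form H a k p : hyperplane H -> lker a = H ->
  rdvd (alpha H ^+ k) p <-> rdvd (linform_poly a ^+ k) p.
Proof.
move=> hH aH; have [||c c0 ->] := @lker_eq_scale (alpha_form H) a.
- exact: alpha_form_neq0.
- by rewrite lker_alpha_form // aH.
rewrite linearZ /= exprZn -!mul_mpolyC.
by split=> /(rdvd_unitl _ _ (mpolyC_unit (\dim {:V}) (expf_neq0 k c0))).
Qed.

End LinearForms.

Section InD.
Variables (K : fieldType) (V : vectType K).
Variables (A : {fset {vspace V}}) (m : {vspace V} -> nat).
Implicit Types (theta eta : Der V).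

Lemma in_D0 : in_D A m 0.
Proof. by move=> H _; exists 0; rewrite der_app0 mulr0. Qed.

Lemma in_DD theta eta : in_D A m theta -> in_D A m eta -> in_D A m (theta + eta).
Proof. by move=> h1 h2 H HA; rewrite der_appD; apply: rdvdD; [apply: h1|apply: h2]. Qed.

Lemma in_DZ c theta : in_D A m theta -> in_D A m (c *: theta).
Proof. by move=> h H HA; rewrite der_appZ; apply: rdvdMl; apply: h. Qed.

Lemma in_DB theta eta : in_D A m theta -> in_D A m eta -> in_D A m (theta - eta).
Proof. by move=> h1 h2; rewrite -scaleN1r; apply/in_DD/in_DZ. Qed.

Lemma in_D_sub (B : {fset {vspace V}}) theta :
  B `<=` A -> in_D A m theta -> in_D B m theta.
Proof. by move=> /fsubsetP BA h H /BA; apply: h. Qed.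

Lemma in_D_const (v : V) : (forall H, H \in A -> hyperplane H /\ v \in H) ->
  in_D A m (const_der v).
Proof.
move=> hA H HA; have [hH vH] := hA H HA; rewrite der_app_const.
move: vH; rewrite -{1}(lker_alpha_form hH) memv_ker => /eqP ->.
by exists 0; rewrite mulr0.
Qed.

Lemma in_D_prod theta : in_D A m ((\prod_(H <- A) alpha H ^+ m H) *: theta).
Proof.
move=> H HA; rewrite der_appZ; apply: rdvdMr.
by rewrite (big_fsetD1 H) //=; apply/rdvdMr/rdvd_refl.
Qed.

End InD.

Lemma in_D_ext (K : fieldType) (V : vectType K) (A : {fset {vspace V}})
    (m m' : {vspace V} -> nat) theta :
  {in A, m =1 m'} -> in_D A m theta -> in_D A m' theta.
Proof. by move=> mm h H HA; rewrite -mm //; apply: h. Qed.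

Section Deletion.
Variables (K : fieldType) (V : vectType K).
Implicit Types (A : {fset {vspace V}}) (m : {vspace V} -> nat).

Lemma deletion_mult_le m H0 H : (deletion_mult m H0 H <= m H)%N.
Proof. by rewrite /deletion_mult; case: eqP => [->|//]; apply: leq_pred. Qed.

Lemma in_D_deletion_mult A m H0 theta :
  in_D A m theta -> in_D A (deletion_mult m H0) theta.
Proof.
by move=> hD H HA; apply: rdvd_trans (hD H HA); apply/rdvd_exp/deletion_mult_le.
Qed.

Lemma sum_deletion_mult A m H0 : H0 \in A -> (0 < m H0)%N ->
  (\sum_(H <- A) deletion_mult m H0 H < \sum_(H <- A) m H)%N.
Proof.
move=> H0A m0; rewrite (big_fsetD1 H0) //= [ltnRHS](big_fsetD1 H0) //=.
rewrite -addSn leq_add //; first by rewrite /deletion_mult eqxx prednK.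
by rewrite big_seq [leqRHS]big_seq leq_sum // => H _; apply: deletion_mult_le.
Qed.

End Deletion.

Section Homog.
Variables (n : nat) (K : fieldType).
Implicit Types (a h p : {mpoly K[n]}).

Lemma pihomogMl k d a h : a \is k.-homog ->
  pihomog mdeg (k + d) (a * h) = a * pihomog mdeg d h.
Proof.
move=> ha; elim/mpolyind: h => [|c m h _ _ IH]; first by rewrite mulr0 !raddf0 mulr0.
rewrite mulrDr !pihomogD IH mulrDr; congr (_ + _).
have hX : a * 'X_[m] \is (k + mdeg m).-homog.
  by apply: dhomogM => //; rewrite dhomogX.
rewrite -scalerAr !linearZ /= -scalerAr; congr (_ *: _).
rewrite pihomogX; case: eqP => [<-|/eqP nd]; first by rewrite pihomog_dE.
by rewrite mulr0 (pihomog_ne0 _ hX) // eqn_add2l.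
Qed.

Lemma pihomogMl_lt k d a h : a \is k.-homog -> (d < k)%N ->
  pihomog mdeg d (a * h) = 0.
Proof.
move=> ha dk; elim/mpolyind: h => [|c m h _ _ IH]; first by rewrite mulr0 raddf0.
rewrite mulrDr pihomogD IH addr0.
have hX : a * 'X_[m] \is (k + mdeg m).-homog.
  by apply: dhomogM => //; rewrite dhomogX.
rewrite -scalerAr !linearZ /= (pihomog_ne0 _ hX) ?scaler0 //.
by rewrite neq_ltn (leq_trans dk) ?orbT // leq_addr.
Qed.

Lemma rdvd_pihomog k d a p : a \is k.-homog -> rdvd a p ->
  rdvd a (pihomog mdeg d p).
Proof.
move=> ha [h ->]; have [dk|kd] := ltnP d k.
  by rewrite (pihomogMl_lt _ ha dk); apply: rdvd0.
by rewrite -(subnKC kd) (pihomogMl _ _ ha); apply/rdvdMr/rdvd_refl.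
Qed.

Lemma homog_quot k d a h : a != 0 -> a \is k.-homog -> a * h \is d.-homog ->
  h != 0 -> (k <= d)%N /\ h \is (d - k).-homog.
Proof.
move=> a0 ha hah h0; have [dk|kd] := ltnP d k.
  have := pihomogMl_lt h ha dk; rewrite pihomog_dE // => /eqP.
  by rewrite mulf_eq0 (negPf a0) (negPf h0).
split=> //; rewrite homog_piE; apply/eqP; apply: (mulfI a0).
by rewrite -(pihomogMl _ _ ha) subnKC // pihomog_dE.
Qed.

End Homog.

(** * Homogeneous bases as lists *)

Section LinComb.
Variables (R : comNzRingType) (M : lmodType R).
Implicit Types (s t : seq M) (x y : M).

(** Membership in the span by recursion on the list: generators can be exchanged or permuted without
    reindexing coefficient families over ['I_(size s)]. *)
Fixpoint lc s x : Prop :=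
  if s is y :: s' then exists c : R, lc s' (x - c *: y) else x = 0.

Lemma lcP s x : lc s x <->
  exists c : 'I_(size s) -> R, x = \sum_i c i *: nth 0 s i.
Proof.
elim: s x => [|y s IH] x /=.
  split=> [->|[c ->]]; last by rewrite big_ord0.
  by exists (fun=> 0); rewrite big_ord0.
split=> [[c /IH [c' E]]|[c ->]].
  exists (fun i => if unlift ord0 i is Some j then c' j else c).
  rewrite big_ord_recl unlift_none /=.
  under eq_bigr => i _ do rewrite liftK.
  by rewrite -E addrC subrK.
exists (c ord0); rewrite big_ord_recl /= addrC addKr; apply/IH.
by exists (fun i => c (lift ord0 i)).
Qed.

Lemma lcD s x y : lc s x -> lc s y -> lc s (x + y).
Proof.
elim: s x y => [|z s IH] x y /=; first by move=> -> ->; rewrite addr0.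
move=> [c cx] [d dy]; exists (c + d).
by rewrite scalerDl opprD addrACA; apply: IH.
Qed.

Lemma lcZ s a x : lc s x -> lc s (a *: x).
Proof.
elim: s x => [|z s IH] x /=; first by move=> ->; rewrite scaler0.
by move=> [c cx]; exists (a * c); rewrite -scalerA -scalerBr; apply: IH.
Qed.

Lemma lc0 s : lc s 0.
Proof. by elim: s => [|z s IH] //=; exists 0; rewrite scale0r subr0. Qed.

Lemma lc_mem s x : x \in s -> lc s x.
Proof.
elim: s => [|z s IH] //=; rewrite inE => /orP [/eqP ->|/IH h].
  by exists 1; rewrite scale1r subrr; apply: lc0.
by exists 0; rewrite scale0r subr0.
Qed.

Lemma lc_sub s t x : (forall y, y \in s -> lc t y) -> lc s x -> lc t x.
Proof.
elim: s x => [|z s IH] x /= h; first by move=> ->; apply: lc0.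
move=> [c cx]; rewrite -[x](subrK (c *: z)); apply: lcD.
  by apply: IH cx => y ys; apply: h; rewrite inE ys orbT.
by apply/lcZ/h/mem_head.
Qed.

Lemma lc_ind (P : M -> Prop) s x :
  P 0 -> (forall y z, P y -> P z -> P (y + z)) ->
  (forall c y, P y -> P (c *: y)) -> (forall y, y \in s -> P y) ->
  lc s x -> P x.
Proof.
move=> P0 PD PZ; elim: s x => [|z s IH] x /= h; first by move=> ->.
move=> [c cx]; rewrite -[x](subrK (c *: z)); apply: (PD).
  by apply: IH cx => y ys; apply: h; rewrite inE ys orbT.
by apply/PZ/h/mem_head.
Qed.

End LinComb.

Lemma lc_map (R R' : comNzRingType) (M : lmodType R) (M' : lmodType R')
    (sigma : R -> R') (f : M -> M') s x :
  f 0 = 0 -> {morph f : y z / y - z} -> (forall c y, f (c *: y) = sigma c *: f y) ->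
  lc s x -> lc (map f s) (f x).
Proof.
move=> f0 fB fZ; elim: s x => [|z s IH] x /=; first by move=> ->.
by move=> [c /IH h]; exists (sigma c); rewrite -fZ -fB.
Qed.

Lemma perm_unzip1 (S T : eqType) (z : seq (S * T)) (e : seq S) :
  perm_eq (unzip1 z) e -> exists2 z', perm_eq z z' & unzip1 z' = e.
Proof.
elim: e z => [|x e IH] z.
  by move=> /perm_size; rewrite size_map; case: z => // _; exists [::].
move=> pz; have : x \in unzip1 z by rewrite (perm_mem pz) mem_head.
case/mapP => -[x' y] zin /= xE; subst x'.
have pz' := perm_to_rem zin; have /IH [z' p' E'] : perm_eq (unzip1 (rem (x, y) z)) e.
  rewrite -(perm_cons x) -(permPr pz) perm_sym.
  by have := perm_map fst pz'.
exists ((x, y) :: z') => /=; last by rewrite E'.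
by rewrite (permPl pz') perm_cons.
Qed.

Section Independence.
Variable R : idomainType.

(** With the vectors as the rows of M, the hypothesis reads C M = Q I, so det M is nonzero;
    multiplying a relation by the adjugate of M then kills its coefficients. *)
Lemma span_free k n (b : 'I_k -> 'rV[R]_n) (Q : R) : k = n -> Q != 0 ->
  (forall i, exists c : 'I_k -> R, Q *: delta_mx 0 i = \sum_j c j *: b j) ->
  forall c : 'I_k -> R, \sum_j c j *: b j = 0 -> forall j, c j = 0.
Proof.
move=> kn; subst k => Q0 /fin_all_exists [C CE] c c0 j.
pose M := \matrix_j b j.
have sumE (d : 'I_n -> R) : \sum_j d j *: b j = (\row_j d j) *m M.
  by rewrite mulmx_sum_row; apply: eq_bigr => k _; rewrite mxE rowK.
have CM : (\matrix_i \row_j C i j) *m M = Q%:M.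
  apply/row_matrixP => i; rewrite row_mul rowK -sumE -CE.
  by rewrite [RHS]rowE mul_mx_scalar.
have dM : \det M != 0.
  apply: contra_neq Q0 => M0; move: (congr1 determinant CM).
  rewrite det_mulmx M0 mulr0 det_scalar => /esym /eqP; rewrite expf_eq0.
  by case/andP => _ /eqP.
have : (\row_j c j) *m M *m \adj M = 0 by rewrite -sumE c0 mul0mx.
rewrite -mulmxA mul_mx_adj mul_mx_scalar => /rowP /(_ j) /eqP.
by rewrite !mxE mulf_eq0 (negPf dM) => /eqP.
Qed.

End Independence.

Section HSpan.
Variables (K : fieldType) (V : vectType K).
Variables (A : {fset {vspace V}}) (m : {vspace V} -> nat).
Hypothesis hA : forall H, H \in A -> hyperplane H.

(** The product of all alpha_H^m(H) multiplies every derivation into D(A, m). Hence dim V generators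
    are automatically independent, and only spanning has to be checked for a basis. *)
Lemma is_basis_span k (b : 'I_k -> Der V) :
  k = \dim {:V} -> (forall i, in_D A m (b i)) ->
  (forall theta, in_D A m theta -> exists c, theta = \sum_i c i *: b i) ->
  is_basis b (in_D A m).
Proof.
move=> kE bD bS; split=> //.
have Q0 : \prod_(H <- A) alpha H ^+ m H != 0.
  rewrite big_seq; elim/big_rec: _ => [|H p HA p0]; first exact: oner_neq0.
  by rewrite mulf_neq0 // expf_neq0 //; have [] := alpha_prime (hA HA).
by apply: (span_free kE Q0) => i; apply/bS/in_D_prod.
Qed.

Lemma is_basis_neq0 k (b : 'I_k -> Der V) D i : is_basis b D -> b i != 0.
Proof.
move=> [_ _ /(_ (fun j => (i == j)%:R)) bf]; apply/eqP => b0.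
have /bf /(_ i) /eqP : \sum_j (i == j)%:R *: b j = 0; last by rewrite eqxx oner_eq0.
rewrite (bigD1 i) //= big1 => [|j ji]; last by rewrite eq_sym (negPf ji) scale0r.
by rewrite b0 scaler0 addr0.
Qed.

(* The entries of z are pairs (degree, derivation). *)
Definition hspan (z : seq (nat * Der V)) : Prop :=
  (forall p, p \in z ->
     in_D A m p.2 /\ forall i, (p.2 : Der V) 0 i \is p.1.-homog) /\
  (forall eta, in_D A m eta -> lc (unzip2 z) eta).

Lemma hspan_perm z z' : perm_eq z z' -> hspan z -> hspan z'.
Proof.
move=> zz [zD zS]; split=> [p|eta /zS]; first by rewrite -(perm_mem zz); apply: zD.
apply: lc_sub => y yz; apply: lc_mem.
by rewrite -(perm_mem (perm_map snd zz)).
Qed.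

Lemma hspan_is_basis z : size z = \dim {:V} -> hspan z ->
  is_basis (fun i : 'I_(size (unzip2 z)) => nth 0 (unzip2 z) i) (in_D A m).
Proof.
move=> sz [zD zS]; apply: is_basis_span; first by rewrite size_map.
  move=> i; have : nth 0 (unzip2 z) i \in unzip2 z by apply: mem_nth.
  by case/mapP => p /zD [hD _] ->.
by move=> theta /zS /lcP [c E]; exists c.
Qed.

Lemma hspan_has_exp z : size z = \dim {:V} -> hspan z -> has_exp A m (unzip1 z).
Proof.
move=> sz zH; have := hspan_is_basis sz zH.
have sE : size (unzip1 z) = size (unzip2 z) by rewrite !size_map.
rewrite /has_exp; set e := unzip1 z => bz.
have bz' : is_basis (fun i : 'I_(size e) => nth 0 (unzip2 z) i) (in_D A m).
  by move: bz; rewrite -/e in sE *; rewrite -sE.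
exists (fun i => nth 0 (unzip2 z) i); split=> // i.
have iz : (i < size z)%N by rewrite -(size_map fst).
split; first exact: (is_basis_neq0 i bz').
move=> j; have [zD _] := zH; have [_ /(_ j)] := zD _ (mem_nth (0%N, 0) iz).
by rewrite /e (nth_map (0%N, 0)) // (nth_map (0%N, 0)).
Qed.

Lemma has_exp_hspan e : has_exp A m e -> exists2 z, unzip1 z = e & hspan z.
Proof.
move=> [b [[bD bS _] bH]].
have sE : size (codom b) = size e by rewrite size_codom card_ord.
exists (zip e (codom b)); first by rewrite unzip1_zip // sE.
split=> [p|eta /bS [c ->]].
  move=> /(nthP (0%N, 0)) [i]; rewrite size1_zip ?sE // => ie <-.
  rewrite nth_zip ?sE //=; have := bH (Ordinal ie) => -[_ /= hh].
  have E : nth 0 (codom b) i = b (Ordinal ie).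
    rewrite codomE (nth_map (Ordinal ie)) ?size_enum_ord //.
    by congr b; apply/val_inj; rewrite /= nth_enum_ord.
  by rewrite E; split.
rewrite unzip2_zip ?sE //.
elim/big_rec: _ => [|i y _ yl]; first exact: lc0.
by apply: lcD => //; apply/lcZ/lc_mem/codom_f.
Qed.

Lemma has_exp_perm e e' : size e = \dim {:V} -> perm_eq e e' ->
  has_exp A m e -> has_exp A m e'.
Proof.
move=> se pe /has_exp_hspan [z zE zH].
have [z' pz z'E] : exists2 z', perm_eq z z' & unzip1 z' = e'.
  by apply: perm_unzip1; rewrite zE.
rewrite -z'E; apply: hspan_has_exp.
  by rewrite -(perm_size pz) -(size_map fst z) -/(unzip1 z) zE.
exact: hspan_perm zH.
Qed.

End HSpan.

(** * Homogeneous components and exchange of a constant derivation *)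

Section Graded.
Variables (K : fieldType) (V : vectType K).
Implicit Types (theta eta : Der V).

Definition der_part (d : nat) theta : Der V :=
  \row_i pihomog mdeg d (theta 0 i).

Lemma const_der_homog0 (v : V) i : const_der v 0 i \is 0.-homog.
Proof. by rewrite mxE -alg_mpolyC; apply/rpredZ/dhomog1. Qed.

Lemma der_app_part d theta a : der_app (der_part d theta) (linform_poly a) =
  pihomog mdeg d (der_app theta (linform_poly a)).
Proof.
rewrite !der_app_linform raddf_sum; apply: eq_bigr => i _.
by rewrite /= mxE linearZ.
Qed.

Lemma der_part_in_D (A : {fset {vspace V}}) m d theta :
  in_D A m theta -> in_D A m (der_part d theta).
Proof.
move=> hD H HA; rewrite der_app_part.
apply: (@rdvd_pihomog _ _ (1 * m H)); last exact: hD.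
exact/dhomogMn/linform_homog.
Qed.

Lemma der_part_id d theta : (forall i, theta 0 i \is d.-homog) ->
  der_part d theta = theta.
Proof. by move=> h; apply/rowP => i; rewrite mxE pihomog_dE. Qed.

Lemma der_partB d theta eta :
  der_part d (theta - eta) = der_part d theta - der_part d eta.
Proof. by apply/rowP => i; rewrite !mxE raddfB. Qed.

Lemma der_partD d theta eta :
  der_part d (theta + eta) = der_part d theta + der_part d eta.
Proof. by apply/rowP => i; rewrite !mxE raddfD. Qed.

Lemma der_partZ d e c theta : (forall i, theta 0 i \is e.-homog) ->
  der_part d (c *: theta) =
  (if (e <= d)%N then pihomog mdeg (d - e) c else 0) *: theta.
Proof.
move=> h; apply/rowP => i; rewrite !mxE mulrC; case: leqP => ed.
  by rewrite -{1}(subnKC ed) (pihomogMl _ _ (h i)) mulrC.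
by rewrite (pihomogMl_lt _ (h i) ed) mul0r.
Qed.

Lemma lc_part d (z : seq (nat * Der V)) theta :
  (forall p, p \in z -> forall i, (p.2 : Der V) 0 i \is p.1.-homog) ->
  lc (unzip2 z) theta -> lc (unzip2 z) (der_part d theta).
Proof.
elim: z theta => [|p z IH] theta hz /=.
  by move=> ->; apply/rowP => i; rewrite !mxE raddf0.
move=> [c cx]; have hp := hz p (mem_head _ _).
exists (if (p.1 <= d)%N then pihomog mdeg (d - p.1) c else 0).
rewrite -(der_partZ _ _ hp) -der_partB; apply: IH => // q qz.
by apply: hz; rewrite inE qz orbT.
Qed.

Lemma homog0_unit n (p : {mpoly K[n]}) : p \is 0.-homog -> p != 0 ->
  p \is a GRing.unit.
Proof.
move=> hp p0; have pE : p = (p@_0)%:MP.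
  apply/mpolyP => k; rewrite mcoeffC; have [->|k0] := eqVneq 0%MM k.
    by rewrite mulr1.
  rewrite mulr0; apply: (dhomog_nemf_coeff hp).
  by rewrite mdeg_eq0 eq_sym.
rewrite pE; apply: mpolyC_unit; apply: contraNneq p0 => c0.
by rewrite pE c0 mpolyC0.
Qed.

(** Steinitz exchange in degree zero: in the degree zero part of an expression of [theta] only
    generators of degree zero survive, with scalar coefficients, and one of these scalars is
    nonzero, hence invertible. *)
Lemma lc_exchange (z : seq (nat * Der V)) theta :
  (forall p, p \in z -> forall i, (p.2 : Der V) 0 i \is p.1.-homog) ->
  (forall i, theta 0 i \is 0.-homog) -> theta != 0 -> lc (unzip2 z) theta ->
  exists p z', [/\ perm_eq z (p :: z'), p.1 = 0%N & lc (theta :: unzip2 z') p.2].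
Proof.
move=> hz th0 tn0; elim: z hz => [|p z IH] hz /=.
  by move=> t0; rewrite t0 eqxx in tn0.
move=> [c cx]; have hp := hz p (mem_head _ _).
have hz' : forall p, p \in z -> forall i, (p.2 : Der V) 0 i \is p.1.-homog.
  by move=> q qz; apply: hz; rewrite inE qz orbT.
have := lc_part 0 hz' cx; rewrite der_partB (der_part_id th0) (der_partZ _ _ hp).
set g := if _ then _ else _; have [->|g0] := eqVneq g 0.
  rewrite scale0r subr0 => /(IH hz') [q [z' [pq q1 lq]]].
  exists q, (p :: z'); split=> //.
    by apply/permP => a; rewrite /= (permP pq a) /= addnCA.
  by move: lq => [d dl]; exists d, 0; rewrite scale0r subr0.
move=> lz; exists p, z; have p10 : p.1 = 0%N.
  by case: (posnP p.1) => // p1; case/eqP: g0; rewrite /g leqNgt p1.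
have gU : g \is a GRing.unit.
  apply: homog0_unit => //; rewrite /g p10 leqnn subn0; exact: pihomogP.
split=> //; exists g^-1.
have -> : p.2 - g^-1 *: theta = (- g^-1) *: (theta - g *: p.2).
  by rewrite scalerBr scalerA mulNr mulVr // scaleN1r opprK addrC scaleNr.
exact: lcZ.
Qed.

End Graded.

(** Puts d/dv, for v in the center, among the homogeneous generators at the cost of one exponent
    zero. Both the extension by C and the restriction to H0 start from generators of this shape. *)
Lemma hspan_exchange (K : fieldType) (V : vectType K) (A : {fset {vspace V}})
    m (v : V) (z : seq (nat * Der V)) :
  (forall H, H \in A -> hyperplane H /\ v \in H) -> v != 0 -> hspan A m z ->
  exists2 z', perm_eq (unzip1 z) (0%N :: unzip1 z') &
    hspan A m ((0%N, const_der v) :: z').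
Proof.
move=> hA v0 [zD zS]; have vD := in_D_const m hA.
have v_hom := const_der_homog0 v.
have [|//|||p [z' [pz p0 lp]]] := @lc_exchange _ _ z (const_der v).
- by move=> p /zD [].
- apply: contra_neq v0 => c0; rewrite (crd_sum v) big1 // => i _.
  have := der_app_const v (crd i); rewrite c0 der_app0 => /esym /eqP.
  by rewrite mpolyC_eq0 => /eqP ->; rewrite scale0r.
- exact: zS.
exists z'; first by rewrite -p0; apply: (perm_map fst pz).
split=> [q|eta /zS].
  rewrite inE => /orP [/eqP -> //|qz]; apply: zD.
  by rewrite (perm_mem pz) inE qz orbT.
apply: lc_sub => y; rewrite (perm_mem (perm_map snd pz)) inE.
case/orP => [/eqP -> //|yz]; apply: lc_mem.
by rewrite inE yz orbT.
Qed.

(** * Passing to the quotient by a central direction *)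

Section Restrict.
Variables (K : fieldType) (U V : vectType K).
Variables (phi : 'Hom(U, V)) (psi : 'Hom(V, U)).
Hypothesis psiK : (psi \o phi)%VF = \1%VF.
Variables (A : {fset {vspace V}}) (m : {vspace V} -> nat).
Variables (B : {fset {vspace U}}) (n : {vspace U} -> nat).
Hypothesis hB : forall Y, Y \in B ->
  [/\ hyperplane Y, hyperplane (psi @^-1: Y)%VS, (psi @^-1: Y)%VS \in A
    & m (psi @^-1: Y)%VS = n Y].
Hypothesis hA : forall H, H \in A -> exists2 Y, Y \in B & H = (psi @^-1: Y)%VS.

Let lker_comp Y (b : 'Hom(U, K^o)) : lker b = Y -> lker (b \o psi)%VF = (psi @^-1: Y)%VS.
Proof. by move=> <-; apply/vspaceP => w; rewrite -memv_preim !memv_ker comp_lfunE. Qed.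

Lemma der_map_in_D theta : in_D A m theta -> in_D B n (der_map phi psi theta).
Proof.
move=> hD Y YB; have [hY hH HA mE] := hB YB.
have := lker_alpha_form hY; move: (alpha_form Y) => b kY.
apply/(in_D_form _ _ hY kY); rewrite der_mapE -mE.
have /(in_D_form _ _ hH (lker_comp kY)) [g ->] := hD _ HA.
rewrite rmorphM rmorphXn /= pull_linform -comp_lfunA psiK comp_lfun1r.
exact/rdvdMr/rdvd_refl.
Qed.

Lemma der_ext_in_D eta : in_D B n eta -> in_D A m (der_map psi phi eta).
Proof.
move=> hD H /hA [Y YB ->]; have [hY hH HA mE] := hB YB.
have := lker_alpha_form hY; move: (alpha_form Y) => b kY.
apply/(in_D_form _ _ hH (lker_comp kY)); rewrite der_mapE mE.
rewrite -comp_lfunA psiK comp_lfun1r.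
have /(in_D_form _ _ hY kY) [g ->] := hD _ YB.
rewrite rmorphM rmorphXn /= pull_linform.
exact/rdvdMr/rdvd_refl.
Qed.

Lemma der_mapK eta : der_map phi psi (der_map psi phi eta) = eta.
Proof.
apply: der_eqP => a; rewrite !der_mapE pull_comp psiK pull_id.
by rewrite -comp_lfunA psiK comp_lfun1r.
Qed.

(** A derivation of the small arrangement is extended to V, expanded there, and restricted again;
    restriction kills d/dv because [psi] kills v. *)
Lemma hspan_restrict v (z : seq (nat * Der V)) : psi v = 0 ->
  hspan A m ((0%N, const_der v) :: z) ->
  hspan B n [seq (p.1, der_map phi psi p.2) | p <- z].
Proof.
move=> v0 [zD zS]; split=> [q /mapP [p pz ->] /=|eta /der_ext_in_D /zS /= [c]].
  have [|hD hh] := zD p; first by rewrite inE pz orbT.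
  split; first exact: der_map_in_D.
  by move=> i; rewrite mxE; apply/pull_homog/der_app_homog.
have mapB : {morph (der_map phi psi) : y x / y - x}.
  by move=> y x; apply/rowP => i; rewrite !mxE der_appB raddfB.
have mapZ c' y : der_map phi psi (c' *: y) = pull phi c' *: der_map phi psi y.
  by apply/rowP => i; rewrite !mxE der_appZ rmorphM.
have map0 : der_map phi psi 0 = 0.
  by rewrite -(subrr (0 : Der V)) mapB !subrr.
move=> /(lc_map map0 mapB mapZ); rewrite mapB mapZ der_mapK.
have -> : der_map phi psi (const_der v) = 0.
  apply: der_eqP => a; rewrite der_mapE der_app_const comp_lfunE v0 linear0.
  by rewrite der_app0 pullC mpolyC0.
by rewrite scaler0 subr0 /unzip2 -!map_comp.
Qed.

End Restrict.

(** * Interpolation by binary forms *)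

Section Interpolation.
Variables (K : fieldType) (I : eqType).

(** Chinese remaindering one node at a time: the solution [f0] for the other nodes is corrected by a
    multiple of their modulus P. A Bezout coefficient [u1] inverts P modulo the new factor Q, and
    reducing the correction modulo Q keeps the size within the total multiplicity. *)
Lemma poly_interpolation (s : seq I) (c : I -> K) (n : I -> nat)
    (g : I -> {poly K}) :
  uniq s -> {in s &, injective c} ->
  exists2 f : {poly K}, (size f <= \sum_(i <- s) n i)%N &
    forall i, i \in s -> ('X - (c i)%:P) ^+ n i %| f - g i.
Proof.
elim: s => [|i s IH] /=; first by exists 0 => //; rewrite size_poly0.
move=> /andP [is_ us] injc.
have [|f0 sf0 f0P] := IH us.
  by move=> j k js ks; apply: injc; rewrite inE ?js ?ks orbT.
pose P := \prod_(j <- s) ('X - (c j)%:P) ^+ n j.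
pose Q := ('X - (c i)%:P) ^+ n i.
have sP : size P = (\sum_(j <- s) n j).+1.
  rewrite /P; elim: {IH us is_ injc f0P sf0 P} s => [|j s IH].
    by rewrite !big_nil size_poly1.
  rewrite !big_cons size_monicM ?monic_neq0 ?size_exp_XsubC ?IH ?addSn ?addnS //.
    by apply: monic_exp; apply: monicXsubC.
  by apply: monic_prod => k _; apply: monic_exp; apply: monicXsubC.
have /Bezout_eq1_coprimepP [[u1 u2] /= E] : coprimep P Q.
  apply: coprimep_expr; rewrite coprimep_XsubC rootE horner_prod big_seq.
  rewrite prodf_seq_neq0; apply/allP => j js; apply/implyP => _.
  rewrite horner_exp hornerXsubC expf_neq0 // subr_eq0; apply: contraNneq is_.
  by move/injc => -> //; rewrite inE ?eqxx ?js ?orbT.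
pose w := (u1 * (g i - f0)) %% Q.
have sw : (size w <= n i)%N.
  have := ltn_modp (u1 * (g i - f0)) Q.
  by rewrite expf_neq0 ?polyXsubC_eq0 // size_exp_XsubC ltnS.
exists (f0 + P * w).
  rewrite big_cons (leq_trans (size_polyD _ _)) // geq_max.
  rewrite (leq_trans sf0) ?leq_addl //= (leq_trans (size_polyMleq _ _)) //.
  by rewrite sP addSn /= addnC leq_add2r.
move=> j; rewrite inE => /orP [/eqP ->|js]; last first.
  rewrite addrAC dvdp_add ?f0P // dvdp_mulr // /P (big_rem j) //=.
  by rewrite dvdp_mulr.
have -> : f0 + P * w - g i =
    (f0 - g i) * (u2 * Q) - P * ((u1 * (g i - f0)) %/ Q) * Q.
  have -> : w = u1 * (g i - f0) - (u1 * (g i - f0)) %/ Q * Q.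
    by apply/eqP; rewrite eq_sym subr_eq [w + _]addrC; apply/eqP; exact: divp_eq.
  have -> : u2 * Q = 1 - u1 * P by rewrite -E addrC addKr.
  by move: (_ %/ _) => k; ring.
by rewrite dvdp_sub // ?dvdp_mulIr // mulrA dvdp_mulIr.
Qed.

End Interpolation.

Section Homogenization.
Variables (K : fieldType) (n : nat) (t y : {mpoly K[n]}).

(** The binary form y^M f(t/y), for f of degree at most M. *)
Definition homogenize (M : nat) (f : {poly K}) : {mpoly K[n]} :=
  \sum_(k < M.+1) f`_k *: (t ^+ k * y ^+ (M - k)).

Lemma homogenizeB M f g :
  homogenize M (f - g) = homogenize M f - homogenize M g.
Proof.
by rewrite /homogenize -sumrB; apply: eq_bigr => k _; rewrite coefB scalerBl.
Qed.

Lemma homogenizeC M c : homogenize M c%:P = c *: y ^+ M.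
Proof.
rewrite /homogenize big_ord_recl coefC /= expr0 mul1r subn0 big1 ?addr0 // => k _.
by rewrite coefC /= scale0r.
Qed.

Lemma homogenize_XsubC M c (q : {poly K}) : (size q <= M.+1)%N ->
  homogenize M.+1 (('X - c%:P) * q) = (t - c *: y) * homogenize M q.
Proof.
move=> sq; rewrite mulrBl homogenizeB mulrBl; congr (_ - _).
  rewrite /homogenize big_ord_recl coefXM /= scale0r add0r mulr_sumr.
  apply: eq_bigr => k _; rewrite coefXM /= -scalerAr; congr (_ *: _).
  by rewrite /bump /= add1n subSS exprS mulrA.
rewrite /homogenize big_ord_recr coefCM /= (nth_default _ sq) mulr0 scale0r addr0.
rewrite mulr_sumr; apply: eq_bigr => k _; rewrite coefCM -scalerAr -scalerAl.
have kM : (k <= M)%N by rewrite -ltnS.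
by rewrite scalerA mulrC subSn // exprS mulrCA.
Qed.

Lemma homogenize_exp M b c (q : {poly K}) : (size q <= M.+1)%N ->
  homogenize (b + M) (('X - c%:P) ^+ b * q) = (t - c *: y) ^+ b * homogenize M q.
Proof.
move=> sq; elim: b => [|b IH]; first by rewrite !expr0 !mul1r.
rewrite exprS -mulrA homogenize_XsubC ?IH ?exprS ?mulrA //.
apply: leq_trans (size_polyMleq _ _) _.
by rewrite size_exp_XsubC addSn /= -addnS leq_add2l.
Qed.

Lemma homogenize_dvd M b c (f : {poly K}) : (size f <= M.+1)%N -> ('X - c%:P) ^+ b %| f ->
  rdvd ((t - c *: y) ^+ b) (homogenize M f).
Proof.
move=> sf /dvdpP [q fE]; have [q0|q0] := eqVneq q 0.
  rewrite fE q0 mul0r -(subrr (0 : {poly K})) homogenizeB subrr.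
  exact: rdvd0.
have sE : size f = (b + size q)%N.
  rewrite fE mulrC size_monicM ?size_exp_XsubC //.
  by apply: monic_exp; apply: monicXsubC.
have q1 : (0 < size q)%N by rewrite size_poly_gt0.
have bM : (b <= M)%N.
  by rewrite -ltnS (leq_trans _ sf) // sE -addn1 leq_add2l.
rewrite fE mulrC -{1}(subnKC bM) homogenize_exp; last first.
  by rewrite -subSn // -(leq_add2l b) subnKC -?sE // leqW.
exact/rdvdMr/rdvd_refl.
Qed.

Lemma homogenize_homog M f : t \is 1.-homog -> y \is 1.-homog ->
  homogenize M f \is M.-homog.
Proof.
move=> ht hy; apply: rpred_sum => k _; apply: rpredZ.
have kM : (k <= M)%N by rewrite -ltnS.
have : t ^+ k * y ^+ (M - k) \is (1 * k + 1 * (M - k)).-homog.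
  by apply: dhomogM; apply: dhomogMn.
by rewrite !mul1n subnKC.
Qed.

(** After setting y = 1 the demand is that f agree with the constant -c_i to order b_i at the node
    -c_i. This Hermite problem has a solution of size at most the sum of the b_i, which homogenizes
    to degree M as long as that sum is at most M + 1. *)
Lemma form_interpolation (I : eqType) (s : seq I) (c : I -> K) (b : I -> nat) M :
  t \is 1.-homog -> y \is 1.-homog -> uniq s -> {in s &, injective c} ->
  (\sum_(i <- s) b i <= M.+1)%N ->
  exists2 f, f \is M.-homog &
    forall i, i \in s -> rdvd ((t + c i *: y) ^+ b i) (f + c i *: y ^+ M).
Proof.
move=> ht hy us injc sM.
have [|f sf fP] := @poly_interpolation K I s (fun i => - c i) b
                     (fun i => (- c i)%:P) us.
  by move=> i j si sj /oppr_inj; apply: injc.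
exists (homogenize M f); first exact: homogenize_homog.
move=> i si; have := @homogenize_dvd M (b i) (- c i) _ _ (fP i si).
rewrite homogenizeB homogenizeC !scaleNr !opprK; apply.
rewrite (leq_trans (size_polyD _ _)) // geq_max size_polyN (leq_trans sf sM) /=.
exact: leq_trans (size_polyC_leq1 _) _.
Qed.

End Homogenization.

(** * Adding hyperplanes off a fixed direction *)

Section HyperplaneGeometry.
Variables (K : fieldType) (V : vectType K).
Implicit Types (H U : {vspace V}) (v w : V).

Lemma hyperplane_cap_dim H H' : hyperplane H -> hyperplane H' -> H != H' ->
  (\dim (H :&: H')).+2 = \dim {:V}.
Proof.
move=> hH hH' nHH; have := dimv_sum_cap H H'.
have -> : \dim (H + H') = \dim {:V}.
  apply/eqP; rewrite eqn_leq dimvS ?subvf //= -hH ltnNge; apply/negP => le.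
  have /eqP sE : H == (H + H')%VS by rewrite eqEdim addvSl.
  by case/eqP: nHH; apply/esym/hyperplane_eq => //; rewrite sE addvSr.
move: hH hH'; rewrite /hyperplane; lia.
Qed.

(* Meaningful only for v outside H; it is 0 otherwise. *)
Definition beta v H : 'Hom(V, K^o) := (alpha_form H v : K)^-1 *: alpha_form H.

Lemma alpha_form_out v H : hyperplane H -> v \notin H -> alpha_form H v != 0.
Proof. by move=> hH; rewrite -{1}(lker_alpha_form hH) memv_ker. Qed.

Lemma beta_v v H : hyperplane H -> v \notin H -> beta v H v = 1.
Proof.
by move=> hH vH; rewrite scale_lfunE; apply/mulVf/alpha_form_out.
Qed.

Lemma lker_beta v H : hyperplane H -> v \notin H -> lker (beta v H) = H.
Proof.
move=> hH vH; rewrite -{2}(lker_alpha_form hH); apply/vspaceP => w.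
rewrite !memv_ker scale_lfunE scaler_eq0 invr_eq0.
by rewrite (negPf (alpha_form_out hH vH)).
Qed.

Lemma beta_neq0 v H : hyperplane H -> v \notin H -> beta v H != 0.
Proof.
move=> hH vH; apply/eqP => b0; have := beta_v hH vH.
by rewrite b0 zero_lfunE => /esym /eqP; rewrite oner_eq0.
Qed.

Lemma beta_inj v H H' : hyperplane H -> v \notin H -> hyperplane H' ->
  v \notin H' -> beta v H = beta v H' -> H = H'.
Proof.
by move=> hH vH hH' vH' E; rewrite -(lker_beta hH vH) E lker_beta.
Qed.

Lemma aproj_beta_mem v H w : hyperplane H -> v \notin H ->
  aproj (beta v H) v w \in H.
Proof.
move=> hH vH; rewrite -{2}(lker_beta hH vH) memv_ker.
by rewrite aproj_ker ?beta_v.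
Qed.

Lemma aproj_mem a v w U : v \in U -> w \in U -> aproj a v w \in U.
Proof. by move=> vU wU; rewrite aprojE rpredB // rpredZ. Qed.

Lemma cap_eq H0 H U : hyperplane H0 -> hyperplane H -> hyperplane U ->
  H0 != H -> H0 != U -> (H0 :&: H <= U)%VS -> (H0 :&: U = H0 :&: H)%VS.
Proof.
move=> h0 hH hU n0H n0U sU; apply/esym/eqP; rewrite eqEdim subv_cap capvSl sU /=.
by rewrite -2!ltnS (hyperplane_cap_dim h0 hU n0U) (hyperplane_cap_dim h0 hH n0H).
Qed.

(** A hyperplane U through v is recovered from its trace on H0, since the projection to H0 along v
    maps U into itself. *)
Lemma cap_inj v H0 U U' : hyperplane H0 -> v \notin H0 -> hyperplane U ->
  hyperplane U' -> v \in U -> v \in U' -> (H0 :&: U <= U')%VS -> U = U'.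
Proof.
move=> h0 v0 hU hU' vU vU' sU; apply: hyperplane_eq => //; apply/subvP => w wU.
have : aproj (beta v H0) v w \in U'.
  by apply: (subvP sU); rewrite memv_cap aproj_beta_mem // aproj_mem.
by rewrite aprojE rpredBr // rpredZ.
Qed.

(** The difference of the two forms vanishes at v and on H0 /\ U, hence on U, so it is a multiple of
    the equation of U; evaluation at u gives the factor. *)
Lemma beta_sub v u H0 H U : hyperplane H0 -> hyperplane H -> hyperplane U ->
  v \notin H0 -> v \notin H -> v \in U -> alpha_form U u = 1 ->
  (H0 :&: U <= H)%VS ->
  beta v H = beta v H0 + (beta v H u - beta v H0 u : K) *: alpha_form U.
Proof.
move=> h0 hH hU v0 vH vU u1 sH.
have [c cE] : exists c : K, beta v H - beta v H0 = c *: alpha_form U.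
  apply: lker_scale; rewrite lker_alpha_form //; apply/subvP => w wU.
  have : beta v H (aproj (beta v H0) v w) == 0.
    rewrite -memv_ker lker_beta //.
    by apply: (subvP sH); rewrite memv_cap aproj_beta_mem // aproj_mem.
  rewrite form_aproj beta_v // mulr1.
  by rewrite memv_ker add_lfunE opp_lfunE.
rewrite -[LHS](subrK (beta v H0)) addrC cE; congr (_ + _ *: _).
have /lfunP /(_ u) := cE; rewrite add_lfunE opp_lfunE => ->.
by rewrite scale_lfunE u1; apply/esym/mulr1.
Qed.

End HyperplaneGeometry.

Section ModularExtension.
Variables (K : fieldType) (V : vectType K) (v : V).
Implicit Types (H U : {vspace V}) (B C : {fset {vspace V}}).
Implicit Types (m : {vspace V} -> nat).

(** Isolates what one step of the filtration provides, for B = A_(r-1), C = A_r \ A_(r-1) and a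
    direction v. The last clause is the hypothesis of the theorem, its first alternative weakened to
    a statement on members of C only. In this form it survives lowering multiplicities on C and
    removing members of C, as the inductions on the total multiplicity of C require. *)
Definition modular_ext B C m : Prop :=
  [/\ forall U, U \in B -> hyperplane U /\ v \in U,
      forall H, H \in C -> hyperplane H /\ v \notin H,
      forall H H', H \in C -> H' \in C -> H != H' ->
        exists2 U, U \in B & (H :&: H' <= U)%VS
    & forall H U, H \in C -> U \in B ->
        (forall H', H' \in C -> (H :&: U <= H')%VS -> H' = H) \/
        (\sum_(H' <- C | (H :&: U <= H')%VS) m H' <= (m U).+1)%N].

Lemma modular_ext_sub B C C' m m' : C' `<=` C -> {in B, m' =1 m} ->
  (forall H, H \in C' -> m' H <= m H)%N ->
  modular_ext B C m -> modular_ext B C' m'.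
Proof.
move=> /fsubsetP sC mB mC [hB hC hBC hm]; split=> //.
- by move=> H /sC /hC.
- by move=> H H' /sC hH /sC hH'; apply: hBC.
move=> H U HC UB; have [h|h] := hm H U (sC _ HC) UB.
  by left=> H' /sC; apply: h.
right; rewrite mB //; apply: leq_trans h.
rewrite [leqRHS](big_fsetIDcond _ (mem C')) /=; apply: leq_trans (leq_addr _ _).
have -> : [fset x in C | x \in C']%fset = C'.
  by apply/fsetP => x; rewrite !inE andb_idl // => /sC.
rewrite big_seq_cond [leqRHS]big_seq_cond.
by apply: leq_sum => H' /andP [/mC].
Qed.

Variables (B C : {fset {vspace V}}).

(* In D(A_X, m_X), X = H0 :&: U, the derivation of degree m U that is not in
   alpha_H0 Der is alpha_U^(m U) d/du + f d/dv, where u is taken in H0. *)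
Lemma ext_form m H0 U u : modular_ext B C m -> H0 \in C -> U \in B ->
  alpha_form U u = 1 ->
  exists2 f : symalg V, f \is (m U).-homog &
    forall H, H \in C -> (H0 :&: U <= H)%VS ->
      rdvd (linform_poly (beta v H) ^+ m H)
           (f + (beta v H u - beta v H0 u : K) *: alpha U ^+ m U).
Proof.
move=> [hB hC hBC hm] H0C UB u1; have [hU vU] := hB U UB.
have [h0 v0] := hC H0 H0C; have [h|h] := hm H0 U H0C UB.
  (* Only H = H0 is to be tested here, and its coefficient beta_H(u) - beta_H0(u) is zero. *)
  exists 0; first exact: dhomog0.
  by move=> H HC /(h H HC) ->; rewrite subrr scale0r addr0; apply: rdvd0.
pose s := [seq H <- C | (H0 :&: U <= H)%VS].
have bE H : H \in s ->
    beta v H = beta v H0 + (beta v H u - beta v H0 u : K) *: alpha_form U.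
  by rewrite mem_filter => /andP [sH /hC [hH vH]]; apply: beta_sub.
have [|||||f hf fP] := @form_interpolation K _ (linform_poly (beta v H0)) (alpha U)
    _ s (fun H => beta v H u - beta v H0 u) m (m U).
- exact: linform_homog.
- exact: linform_homog.
- by rewrite filter_uniq // fset_uniq.
- move=> H H' Hs H's E; have := bE _ Hs; rewrite E -bE // => bb.
  move: Hs H's; rewrite !mem_filter => /andP [_ /hC [hH vH]] /andP [_ /hC [hH' vH']].
  exact: beta_inj bb.
- by rewrite big_filter.
exists f => // H HC sH; have Hs : H \in s by rewrite mem_filter sH HC.
have := fP H Hs; rewrite -[_ *: alpha U]linearZ -linearD /= -bE //.
Qed.

Section OneStep.
Variables (m : {vspace V} -> nat) (H0 : {vspace V}) (eta : Der V).
Hypothesis hE : modular_ext B C m.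
Hypothesis H0C : H0 \in C.
Hypothesis m0 : (0 < m H0)%N.
Hypothesis etaB : in_D B m eta.
Hypothesis etaC : in_D C (deletion_mult m H0) eta.
Variable g : symalg V.
Hypothesis gE : der_app eta (linform_poly (beta v H0)) =
  linform_poly (beta v H0) ^+ (m H0).-1 * g.

Let rho := pull (aproj (beta v H0) v).

Lemma rho_beta H U u : H \in C -> U \in B -> alpha_form U u = 1 ->
  (H0 :&: U <= H)%VS ->
  rho (linform_poly (beta v H)) = (beta v H u - beta v H0 u : K) *: alpha U.
Proof.
move=> HC UB u1 sH; have [hB hC _ _] := hE; have [hU vU] := hB U UB.
have [h0 v0] := hC H0 H0C; have [hH vH] := hC H HC.
have := beta_sub h0 hH hU v0 vH vU u1 sH.
set c : K := (_ - _ : K) => cE; rewrite /rho pull_linform cE.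
rewrite -linearZ; congr linform_poly; apply/lfunP => w.
rewrite comp_lfunE add_lfunE aproj_ker ?beta_v // add0r !scale_lfunE form_aproj.
by move: vU; rewrite -{1}(lker_alpha_form hU) memv_ker => /eqP ->; rewrite mulr0 subr0.
Qed.

(** Let h be the quotient of eta(alpha_U) by alpha_U^m(U). Subtracting from eta the h-fold multiple
    of the local derivation given by [ext_form] turns g into G = g - h t f', where t = beta_H0 and f
    = t^m(H0) f'. Reduction modulo t does not see the change, and G is divisible by beta_H^m(H) for
    every other H of C through H0 /\ U. *)
Lemma local_divisibility U : U \in B ->
  rdvd (\prod_(H <- C `\ H0 | (H0 :&: U <= H)%VS) rho (linform_poly (beta v H)) ^+ m H)
       (rho g).
Proof.
move=> UB; have [hB hC _ _] := hE; have [hU vU] := hB U UB.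
have [h0 v0] := hC H0 H0C.
have [u u1] := form_neq0 (alpha_form_neq0 hU).
have [f hf fP] := ext_form hE H0C UB u1.
have [f' fE] : rdvd (linform_poly (beta v H0) ^+ m H0) f.
  by have := fP H0 H0C (capvSl _ _); rewrite subrr scale0r addr0.
have [h hh] := etaB UB.
pose t := linform_poly (beta v H0); pose G := g - h * t * f'.
have GP : rdvd (\prod_(H <- C `\ H0 | (H0 :&: U <= H)%VS) linform_poly (beta v H) ^+ m H) G.
  apply: rprime_prod_dvd; first exact: fset_uniq.
  - move=> H; rewrite in_fsetD1 => /andP [_ /hC [hH vH]] _.
    exact/linform_prime/beta_neq0.
  - move=> H H'; rewrite !in_fsetD1 => /andP [_ /hC [hH vH]] /andP [_ /hC [hH' vH']].
    move=> _ _ /eqP nHH /rdvd_linform; rewrite !lker_beta // => sHH.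
    exact/nHH/hyperplane_eq.
  move=> H; rewrite in_fsetD1 => /andP [nH HC] sH; have [hH vH] := hC H HC.
  apply: (@rprime_exp _ _ (t ^+ (m H0).-1)).
  - exact/linform_prime/beta_neq0.
  - apply: rprime_expn; first exact/linform_prime/beta_neq0.
    move=> /rdvd_linform; rewrite !lker_beta // => sHH.
    by case/eqP: nH; apply: hyperplane_eq.
  (* Both summands are divisible by beta_H^m(H): the first since eta is in D(C, m'),
     the second by the choice of f. *)
  have -> : t ^+ (m H0).-1 * G =
      der_app eta (linform_poly (beta v H)) -
      h * (f + (beta v H u - beta v H0 u : K) *: alpha U ^+ m U).
    have := beta_sub h0 hH hU v0 vH vU u1 sH.
    set c : K := (_ - _ : K) => cE.
    rewrite cE der_appDr gE der_appZr -/(alpha U) hh fE -/t -!mul_mpolyC /G.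
    by rewrite -{3}(prednK m0) exprS; ring.
  apply: rdvdB; last by apply/rdvdMl/fP.
  have := etaC HC; rewrite /deletion_mult (negPf nH).
  by move/(in_D_form _ _ hH (lker_beta hH vH)).
have [k kE] := GP; exists (rho k).
have -> : rho g = rho G.
  rewrite /G /rho raddfB /= !rmorphM /= -/rho.
  have -> : rho t = 0 by apply/(rdvd_aproj _ (beta_v h0 v0)); apply: rdvd_refl.
  by rewrite mulr0 mul0r subr0.
rewrite kE /rho rmorphM rmorph_prod; congr (_ * _).
by apply: eq_bigr => H _; rewrite rmorphXn.
Qed.

(** This is the solvability condition for raising the multiplicity at H0 by one. Each H other than
    H0 meets H0 in the trace of exactly one U of B, and beta_H reduces to a nonzero multiple of
    alpha_U. So the product over one class is a power of alpha_U up to a scalar, and the alpha_U of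
    different classes are non-associated primes. *)
Lemma global_divisibility :
  rdvd (\prod_(H <- C `\ H0) rho (linform_poly (beta v H)) ^+ m H) (rho g).
Proof.
have [hB hC hBC _] := hE; have [h0 v0] := hC H0 H0C.
pose E U := \prod_(H <- C `\ H0 | (H0 :&: U <= H)%VS)
              rho (linform_poly (beta v H)) ^+ m H.
have -> : \prod_(H <- C `\ H0) rho (linform_poly (beta v H)) ^+ m H =
          \prod_(U <- B) E U.
  rewrite /E (exchange_big_dep predT) //= big_seq [RHS]big_seq.
  apply: eq_bigr => H; rewrite in_fsetD1 => /andP [nH HC].
  have [hH vH] := hC H HC; rewrite eq_sym in nH.
  have [U UB sU] := hBC _ _ H0C HC nH; have [hU vU] := hB U UB.
  have n0 W : W \in B -> H0 != W.
    by move=> /hB [_ vW]; apply: contraNneq v0 => ->.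
  rewrite big_seq_cond (eq_bigl (pred1 U)).
    by rewrite -big_filter filter_pred1_uniq ?fset_uniq // big_seq1.
  move=> W /=; apply/andP/eqP => [[WB sW]|->].
    have [hW vW] := hB W WB; apply: (cap_inj h0 v0) => //.
    by rewrite -(cap_eq h0 hW hH (n0 _ WB) nH sW).
  by split=> //; rewrite (cap_eq h0 hH hU nH (n0 _ UB) sU) capvSr.
pose n U := (\sum_(H <- C `\ H0 | (H0 :&: U <= H)%VS) m H)%N.
have EE U : U \in B -> exists2 c : K, c != 0 & E U = c%:MP * alpha U ^+ n U.
  move=> UB; have [hU vU] := hB U UB.
  have [u u1] := form_neq0 (alpha_form_neq0 hU).
  rewrite /E /n big_seq_cond [X in alpha U ^+ X]big_seq_cond.
  elim/big_rec2: _ => [|H d p /andP []]; first by exists 1; rewrite ?oner_neq0 // mul1r.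
  rewrite in_fsetD1 => /andP [nH HC] sH [c c0 ->]; have [hH vH] := hC H HC.
  rewrite (rho_beta HC UB u1 sH) -mul_mpolyC.
  exists ((beta v H u - beta v H0 u : K) ^+ m H * c).
    rewrite mulf_neq0 // expf_neq0 //; apply: contraNneq nH => c0'.
    apply/eqP; apply: (beta_inj hH vH h0 v0).
    by rewrite (beta_sub h0 hH hU v0 vH vU u1 sH) c0' scale0r addr0.
  by rewrite exprMn exprD mpolyCM rmorphXn mulrACA.
have [E' E'E] : exists2 c : K, c != 0 &
    \prod_(U <- B) E U = c%:MP * \prod_(U <- B) alpha U ^+ n U.
  rewrite !big_seq.
  elim/big_rec2: _ => [|U p q /EE [d d0 ->] [c c0 ->]].
    by exists 1; rewrite ?oner_neq0 // mul1r.
  exists (d * c); first by rewrite mulf_neq0.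
  by rewrite mpolyCM mulrACA.
move=> ->; apply/(rdvd_unitl _ _ (mpolyC_unit _ E'E)).
apply: rprime_prod_dvd; first exact: fset_uniq.
- by move=> U /hB [hU _] _; apply: alpha_prime.
- by move=> U U' /hB [hU _] /hB [hU' _] _ _; apply: alpha_ndvd.
move=> U UB _; have [c c0 EU] := EE U UB.
by have := local_divisibility UB; rewrite -/(E U) EU => /(rdvd_unitl _ _ (mpolyC_unit _ c0)).
Qed.

End OneStep.
End ModularExtension.

(** * Lifting derivations across the added hyperplanes *)

Section Lift.
Variables (K : fieldType) (V : vectType K) (v : V).
Variables (B C : {fset {vspace V}}).
Implicit Types (H U : {vspace V}) (m : {vspace V} -> nat).

Lemma pull_aprojK (a : 'Hom(V, K^o)) p : a v = 1 ->
  pull (aproj a v) (pull (aproj a v) p) = pull (aproj a v) p.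
Proof.
move=> av; have /(rdvd_aproj _ av) := aproj_mod a v p.
by rewrite raddfB => /eqP; rewrite subr_eq0 => /eqP.
Qed.

Lemma der_lift m theta : modular_ext v B C m -> in_D B m theta ->
  exists f : symalg V, in_D C m (theta + f *: const_der v).
Proof.
have [n] := ubnP (\sum_(H <- C) m H)%N; elim: n m => // n IH m.
rewrite ltnS => Cn hE thB; have [hB hC _ _] := hE.
have [/hasP [H0 H0C m0]|/hasPn m0] := boolP (has (fun H => 0 < m H)%N C); last first.
  exists 0; rewrite scale0r addr0 => H HC.
  have /eqP -> : m H == 0%N by rewrite -leqn0 leqNgt m0.
  by rewrite expr0; apply: rdvd1.
have [h0 v0] := hC H0 H0C; pose m' := deletion_mult m H0.
have m'B : {in B, m' =1 m}.
  by move=> U UB; rewrite /m' /deletion_mult; case: eqP v0 => // <-; rewrite (hB U UB).2.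
have m'C H : (m' H <= m H)%N by apply: deletion_mult_le.
have [|||f' etaC] := IH m'.
- exact: leq_trans (sum_deletion_mult H0C m0) Cn.
- by apply: modular_ext_sub hE => //; apply: fsubset_refl.
- by apply: in_D_ext thB => U UB; rewrite m'B.
set eta := theta + _ in etaC.
have etaB : in_D B m eta by apply/in_DD/in_DZ/in_D_const.
have [g gE] : rdvd (linform_poly (beta v H0) ^+ (m H0).-1)
                   (der_app eta (linform_poly (beta v H0))).
  have := etaC H0 H0C; rewrite /m' /deletion_mult eqxx.
  by move/(in_D_form _ _ h0 (lker_beta h0 v0)).
have [k kE] := global_divisibility hE H0C m0 etaB etaC gE.
set P := \prod_(H <- C `\ H0) linform_poly (beta v H) ^+ m H.
set t := linform_poly (beta v H0) in gE.
(* P protects the conditions at the other members of C, the power of t those already reached at H0,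
   and k makes g - P k vanish modulo t. Only rho(g) = rho(P) k is known, with rho the reduction
   modulo t, so idempotence of rho is used to replace k by rho(k). *)
exists (f' - t ^+ (m H0).-1 * (P * k)).
have -> : theta + (f' - t ^+ (m H0).-1 * (P * k)) *: const_der v =
    eta - (t ^+ (m H0).-1 * (P * k)) *: const_der v.
  by rewrite scalerBl addrA.
move=> H HC; have [hH vH] := hC H HC.
apply/(in_D_form _ _ hH (lker_beta hH vH)).
rewrite der_appB der_appZ der_app_const beta_v // mpolyC1 mulr1.
have [->|nH] := eqVneq H H0.
  rewrite gE -/t -mulrBr -{1}(prednK m0) exprSr; apply: rdvdM; first exact: rdvd_refl.
  apply/(rdvd_aproj _ (beta_v h0 v0)); rewrite raddfB /= rmorphM /=.
  rewrite -{1}(pull_aprojK _ (beta_v h0 v0)) kE rmorphM /=.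
  rewrite rmorph_prod /P rmorph_prod -mulrBl.
  rewrite [X in X * _](_ : _ = 0) ?mul0r //; apply/eqP; rewrite subr_eq0; apply/eqP.
  by apply: eq_bigr => W _; rewrite !rmorphXn /= pull_aprojK // beta_v.
apply: rdvdB.
  have := etaC H HC; rewrite /m' /deletion_mult (negPf nH).
  by move/(in_D_form _ _ hH (lker_beta hH vH)).
apply/rdvdMl/rdvdMr; rewrite /P (big_fsetD1 H) ?in_fsetD1 ?nH //=.
exact/rdvdMr/rdvd_refl.
Qed.

Variable m : {vspace V} -> nat.
Hypothesis hE : modular_ext v B C m.

Lemma in_D_ext_const f : in_D C m (f *: const_der v) ->
  rdvd (\prod_(H <- C) linform_poly (beta v H) ^+ m H) f.
Proof.
move=> fD; have [_ hC _ _] := hE; apply: rprime_prod_dvd; first exact: fset_uniq.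
- by move=> H /hC [hH vH] _; apply/linform_prime/beta_neq0.
- move=> H H' /hC [hH vH] /hC [hH' vH'] _ _ /eqP nH /rdvd_linform.
  by rewrite !lker_beta // => sH; apply/nH/hyperplane_eq.
move=> H HC _; have [hH vH] := hC H HC.
have /(in_D_form _ _ hH (lker_beta hH vH)) := fD H HC.
by rewrite der_appZ der_app_const beta_v // mpolyC1 mulr1.
Qed.

Lemma in_D_prod_const :
  in_D (B `|` C) m ((\prod_(H <- C) linform_poly (beta v H) ^+ m H) *: const_der v).
Proof.
have [hB hC _ _] := hE => H; rewrite in_fsetU => /orP [HB|HC].
  by apply: in_DZ HB; apply: in_D_const.
have [hH vH] := hC H HC; apply/(in_D_form _ _ hH (lker_beta hH vH)).
rewrite der_appZ; apply: rdvdMr; rewrite (big_fsetD1 H) //=.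
exact/rdvdMr/rdvd_refl.
Qed.

Lemma in_DU theta : in_D B m theta -> in_D C m theta -> in_D (B `|` C) m theta.
Proof. by move=> hB hC H; rewrite in_fsetU => /orP [/hB|/hC]. Qed.

Lemma prod_beta_homog (s : seq {vspace V}) :
  \prod_(H <- s) linform_poly (beta v H) ^+ m H \is (\sum_(H <- s) m H).-homog.
Proof.
elim: s => [|H s IH]; first by rewrite !big_nil; apply: dhomog1.
rewrite !big_cons; apply: dhomogM IH; rewrite -[X in X.-homog]mul1n.
exact/dhomogMn/linform_homog.
Qed.

(** For spanning, expand eta over the generators of D(B, m) and replace each generator by its lift.
    What is left over is a multiple of d/dv lying in D(C, m), and its coefficient is divisible by
    every beta_H^m(H), hence by their product. *)
Lemma hspan_modular_ext z : hspan B m ((0%N, const_der v) :: z) ->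
  exists2 z', unzip1 z' = mult_size C m :: unzip1 z & hspan (B `|` C) m z'.
Proof.
move=> [zD zS]; have [hB hC _ _] := hE.
have [z' [z'1 z'D z'S]] : exists z', [/\ unzip1 z' = unzip1 z,
    forall p, p \in z' -> in_D (B `|` C) m p.2 /\
      forall i, (p.2 : Der V) 0 i \is p.1.-homog
    & forall eta, lc (unzip2 z) eta ->
        exists c, lc (unzip2 z') (eta - c *: const_der v)].
  have {zD zS} : forall p, p \in z -> in_D B m p.2 /\
      forall i, (p.2 : Der V) 0 i \is p.1.-homog.
    by move=> p pz; apply: zD; rewrite inE pz orbT.
  elim: z => [|[d th] z IH] hz.
    by exists [::]; split=> // eta /= ->; exists 0; rewrite scale0r subr0.
  case: IH => [p pz|z' [z'1 z'D z'S]]; first by apply: hz; rewrite inE pz orbT.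
  have [thD thh] := hz _ (mem_head _ _).
  have [f fD] := der_lift hE thD.
  (* The polynomial f need not be homogeneous; the degree d component of the lift is again a lift of
     [th]. *)
  have := der_part_in_D d fD; rewrite /= in thh.
  have -> : der_part d (th + f *: const_der v) =
            th + pihomog mdeg d f *: const_der v.
    rewrite der_partD der_part_id //.
    by rewrite (der_partZ _ _ (const_der_homog0 v)) leq0n subn0.
  set th' := th + _ => th'D; exists ((d, th') :: z'); split.
  - by rewrite /= z'1.
  - move=> p; rewrite inE => /orP [/eqP -> /=|/z'D //]; split.
      by apply: in_DU => //; apply/in_DD/in_DZ/in_D_const.
    move=> i; rewrite mxE; apply: rpredD => //.
    rewrite mxE -[d]addn0; apply: dhomogM; last exact: const_der_homog0.
    by rewrite addn0; apply: pihomogP.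
  move=> eta /= [c /z'S [c' h]].
  exists (c' - c * pihomog mdeg d f), c; rewrite /th'.
  suff -> : forall d' : Der V, eta - (c' - c * pihomog mdeg d f) *: d' -
      c *: (th + pihomog mdeg d f *: d') = eta - c *: th - c' *: d' by [].
  move=> d'; rewrite scalerBl scalerDr scalerA opprB addrA [c *: th + _]addrC.
  by rewrite opprD addrA (addrAC _ (- (c' *: d'))) addrK addrAC.
pose psi := (\prod_(H <- C) linform_poly (beta v H) ^+ m H) *: const_der v.
exists ((mult_size C m, psi) :: z'); first by rewrite /= z'1.
split=> [p|eta etaD].
  rewrite inE => /orP [/eqP -> /=|/z'D //]; split; first exact: in_D_prod_const.
  move=> i; rewrite mxE -[mult_size C m]addn0; apply: dhomogM.
    exact: prod_beta_homog.
  exact: const_der_homog0.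
have [c] : lc (unzip2 ((0%N, const_der v) :: z)) eta.
  by apply/zS/in_D_sub/etaD/fsubsetUl.
rewrite -/(unzip2 z) => /z'S [c' h].
have zetaD : in_D (B `|` C) m (eta - c *: const_der v - c' *: const_der v).
  apply: (lc_ind _ _ _ _ h); first exact: in_D0.
  - by move=> *; apply: in_DD.
  - by move=> *; apply: in_DZ.
  by move=> y /mapP [p /z'D [hD _] ->].
have cD : in_D C m ((c + c') *: const_der v).
  apply: (@in_D_sub _ _ (B `|` C)); first exact: fsubsetUr.
  have -> : (c + c') *: const_der v =
      eta - (eta - c *: const_der v - c' *: const_der v).
    by rewrite -addrA -opprD -scalerDl subKr.
  exact: in_DB.
have [k kE] := in_D_ext_const cD.
exists k; rewrite /psi scalerA [k * _]mulrC -kE scalerDl opprD addrA.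
exact: h.
Qed.

End Lift.

Lemma scale_const_der_homog (K : fieldType) (V : vectType K) (w : V) (d : nat)
    (p : symalg V) :
  p \is d.-homog -> forall i, (p *: const_der w) 0 i \is d.-homog.
Proof.
move=> ph i; rewrite mxE -[d]addn0.
by apply: dhomogM; [|apply: const_der_homog0].
Qed.

(** * Rank two localizations and Euler multiplicities *)

Section RankTwo.
Variables (K : fieldType) (V : vectType K).
Implicit Types (a y f : 'Hom(V, K^o)) (X H U : {vspace V}) (u v w : V).

Lemma form_decomp a y u v f : a v = 1 -> a u = 0 -> y v = 0 -> y u = 1 ->
  (lker a :&: lker y <= lker f)%VS -> f = (f v : K) *: a + (f u : K) *: y.
Proof.
move=> av au yv yu sf; apply/lfunP => w; rewrite add_lfunE !scale_lfunE.
have : w - (a w : K) *: v - (y w : K) *: u \in lker f.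
  apply: (subvP sf); rewrite memv_cap !memv_ker !linearB /= !form_scale av au yv yu.
  by rewrite !mulr1 !mulr0 !subr0 !subrr eqxx.
rewrite memv_ker !linearB /= !form_scale -addrA -opprD subr_eq0 => /eqP ->.
by congr (_ + _); rewrite mulrC.
Qed.

Lemma der_decomp theta a y u v f : a v = 1 -> a u = 0 -> y v = 0 -> y u = 1 ->
  (lker a :&: lker y <= lker f)%VS ->
  der_app theta (linform_poly f) =
    (f v : K)%:MP * der_app theta (linform_poly a) +
    (f u : K)%:MP * der_app theta (linform_poly y).
Proof.
move=> av au yv yu sf; rewrite (form_decomp av au yv yu sf) der_appDr !der_appZr.
rewrite -!mul_mpolyC !add_lfunE !scale_lfunE av au yv yu.
rewrite ![_ *: (1 : K^o)]mulr1 ![_ *: (0 : K^o)]mulr0 addr0 add0r.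
by [].
Qed.

(** Let p_i be the coordinates of the basis of X, extended to V by a projection. Then f - sum of
    f(e_i) p_i vanishes on X for every form f, so zeta is determined by its values on the p_i. *)
Lemma lc_const_der X (e : seq V) (zeta : Der V) : basis_of X e ->
  (forall f, (X <= lker f)%VS -> der_app zeta (linform_poly f) = 0) ->
  lc [seq const_der w | w <- e] zeta.
Proof.
move=> eX hz; pose t := in_tuple e.
have tX : basis_of X t by [].
pose p i : 'Hom(V, K^o) := (linfun (coord t i : V -> K^o) \o projv X)%VF.
have pE i w : p i w = coord t i (projv X w) by rewrite comp_lfunE lfunE.
have -> : zeta = \sum_(i < size e) der_app zeta (linform_poly (p i)) *: const_der e`_i.
  apply: der_eqP => f; apply/eqP; rewrite -subr_eq0; apply/eqP.
  rewrite -[RHS](hz (f - \sum_(i < size e) (f e`_i : K) *: p i)); last first.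
    apply/subvP => w wX; rewrite memv_ker add_lfunE opp_lfunE sum_lfunE subr_eq0.
    rewrite {1}(coord_basis tX wX) linear_sum; apply/eqP; apply: eq_bigr => i _.
    by rewrite /= form_scale scale_lfunE pE projv_id // mulrC.
  rewrite der_appBr; congr (_ - _).
  transitivity (\sum_(i < size e) der_app zeta (linform_poly ((f e`_i : K) *: p i))).
    elim/big_rec2: _ => [|i q d _ IH]; first exact: der_app0.
    by rewrite der_appD der_appZ der_app_const der_appZr IH -mul_mpolyC mulrC.
  elim/big_rec2: _ => [|i q d _ ->]; last by rewrite der_appDr.
  by rewrite der_app_linform big1 // => i _; rewrite zero_lfunE scale0r.
elim/big_rec: _ => [|i d _ dl]; first exact: lc0.
by apply: lcD => //; apply/lcZ/lc_mem/map_f/mem_nth.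
Qed.

Lemma hspan_rank2 A m X (e : seq V) theta psi d p :
  (forall H, H \in A -> hyperplane H /\ (X <= H)%VS) -> basis_of X e ->
  in_D A m theta -> (forall i, theta 0 i \is d.-homog) ->
  in_D A m psi -> (forall i, psi 0 i \is p.-homog) ->
  (forall eta, in_D A m eta -> exists b c, forall f, (X <= lker f)%VS ->
     der_app eta (linform_poly f) = b * der_app theta (linform_poly f) +
                                    c * der_app psi (linform_poly f)) ->
  hspan A m [:: (d, theta), (p, psi) & [seq (0%N, const_der w) | w <- e]].
Proof.
move=> hA eX thD thh psD psh hS; split=> [q|eta /hS [b [c E]]].
  rewrite !inE => /or3P [/eqP ->|/eqP ->|/mapP [w we ->]] //; split.
    apply: in_D_const => H /hA [hH sH]; split=> //.
    by apply: (subvP sH); apply: (basis_mem eX).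
  by move=> i; apply: const_der_homog0.
rewrite /unzip2 /= -map_comp; exists b, c; apply: (lc_const_der eX) => f sf.
by rewrite !der_appB !der_appZ E // addrAC addrK subrr.
Qed.

Lemma euler_mult_rank2 (H0 : {vspace V}) (Y : {vspace subvs_of H0}) A m
    (X : {vspace V}) theta psi d p :
  (incl H0 @: Y)%VS = X -> (\dim X).+2 = \dim {:V} ->
  (forall H, H \in A -> hyperplane H) ->
  in_D (localization A X) m theta -> (forall i, theta 0 i \is d.-homog) ->
  in_D (localization A X) m psi -> (forall i, psi 0 i \is p.-homog) ->
  (forall eta, in_D (localization A X) m eta ->
     exists b c, forall f, (X <= lker f)%VS ->
     der_app eta (linform_poly f) = b * der_app theta (linform_poly f) +
                                    c * der_app psi (linform_poly f)) ->
  ~ in_alphaDer H0 theta -> in_alphaDer H0 psi ->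
  euler_mult A m Y d.
Proof.
move=> YX dX hA thD thh psD psh hS nal aps.
have hL H : H \in localization A X -> hyperplane H /\ (X <= H)%VS.
  by rewrite !inE => /andP [/hA].
have := hspan_rank2 hL (vbasisP X) thD thh psD psh hS; set z := (_ :: _) => zS.
have sz : size z = \dim {:V} by rewrite /= size_map size_tuple.
have := hspan_is_basis (fun H HL => (hL H HL).1) sz zS.
rewrite /euler_mult YX; have -> : unzip2 z = [:: theta, psi & [seq const_der w | w <- vbasis X]].
  by rewrite /z /unzip2 /= -map_comp.
move: (vbasis X) (vbasisP X) => e eX bz.
exists theta, psi, p, e; split=> //.
have b0 := is_basis_neq0 (Ordinal (isT : (0 < (size [seq const_der w | w <- e]).+2)%N)) bz.
have b1 := is_basis_neq0 (Ordinal (isT : (1 < (size [seq const_der w | w <- e]).+2)%N)) bz.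
by [].
Qed.

End RankTwo.

Section Trace.
Variables (K : fieldType) (V : vectType K) (H0 : {vspace V}).

Lemma inclE (w : subvs_of H0) : incl H0 w = vsval w.
Proof. by rewrite lfunE. Qed.

Lemma mem_trace_on (U : {vspace V}) w : (w \in trace_on H0 U) = (vsval w \in U).
Proof. by rewrite -memv_preim inclE. Qed.

Lemma incl_trace_on (U : {vspace V}) : (incl H0 @: trace_on H0 U)%VS = (H0 :&: U)%VS.
Proof.
apply/vspaceP => w; rewrite memv_cap; apply/memv_imgP/andP => [[x]|[wH wU]].
  by rewrite mem_trace_on => xU ->; rewrite inclE; split=> //; apply: subvsP.
exists (vsproj H0 w); last by rewrite inclE vsprojK.
by rewrite mem_trace_on vsprojK.
Qed.

Lemma dim_trace_on (U : {vspace V}) : \dim (trace_on H0 U) = \dim (H0 :&: U).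
Proof.
rewrite -incl_trace_on limg_dim_eq //; apply/eqP; rewrite -subv0.
apply/subvP => w; rewrite memv_cap => /andP [_]; rewrite memv_ker inclE memv0.
by move=> /eqP w0; apply/eqP/val_inj.
Qed.

Lemma hyperplane_trace_on (U : {vspace V}) : hyperplane H0 -> hyperplane U ->
  H0 != U -> hyperplane (trace_on H0 U).
Proof.
move=> h0 hU nU; rewrite /hyperplane dim_trace_on dimvf /dim /=.
by apply/eqP; rewrite -eqSS (hyperplane_cap_dim h0 hU nU) h0.
Qed.

End Trace.

Section EulerModular.
Variables (K : fieldType) (V : vectType K) (v : V).
Variables (B C : {fset {vspace V}}) (m : {vspace V} -> nat).

(** The basis consists of theta = alpha_U^m(U) d/du + f d/dv, with f from [ext_form] and u in H0, of
    psi = Q d/dv with Q the product of the beta_H^m(H) over the members of C through X, and of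
    constants along X. Once a multiple of theta is subtracted to kill alpha_U, a derivation takes
    the same value on all these beta_H, and that value is divisible by Q. Evaluation at alpha_U
    shows that theta is not divisible by alpha_H0, whereas Q contains a positive power of
    beta_H0. *)
Lemma euler_mult_modular H0 U : modular_ext v B C m -> H0 \in C -> U \in B ->
  (0 < m H0)%N -> euler_mult (B `|` C) m (trace_on H0 U) (m U).
Proof.
move=> hE H0C UB m0; have [hB hC _ _] := hE.
have [hU vU] := hB U UB; have [h0 v0] := hC H0 H0C.
have n0 : H0 != U by apply: contraNneq v0 => ->.
set X := (H0 :&: U)%VS; set L := localization (B `|` C) X.
have a0v := beta_v h0 v0; have k0 := lker_beta h0 v0.
have kU := lker_alpha_form hU.
have Uv : alpha_form U v = 0 by apply/eqP; rewrite -memv_ker kU.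
have [u [u1 u0]] : exists u, alpha_form U u = 1 /\ beta v H0 u = 0.
  have [u u1] := form_neq0 (alpha_form_neq0 hU).
  exists (aproj (beta v H0) v u); split; last by rewrite aproj_ker.
  by rewrite form_aproj u1 Uv mulr0 subr0.
have XE : (lker (beta v H0) :&: lker (alpha_form U) = X)%VS by rewrite k0 kU.
have LB W : W \in B -> (X <= W)%VS -> W = U.
  by move=> /hB [hW vW] sW; apply/esym/(cap_inj h0 v0).
have [f fh fP] := ext_form hE H0C UB u1.
pose theta : Der V := alpha U ^+ m U *: const_der u + f *: const_der v.
pose Q := \prod_(H <- C | (X <= H)%VS) linform_poly (beta v H) ^+ m H.
pose psi : Der V := Q *: const_der v.
have thE g : der_app theta (linform_poly g) =
    alpha U ^+ m U * (g u : K)%:MP + f * (g v : K)%:MP.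
  by rewrite der_appD !der_appZ !der_app_const.
have psE g : der_app psi (linform_poly g) = Q * (g v : K)%:MP.
  by rewrite der_appZ der_app_const.
have LP H : H \in L -> H = U \/ [/\ H \in C, (X <= H)%VS, hyperplane H & v \notin H].
  rewrite !inE => /andP [/orP [HB|HC] sH]; first by left; apply: LB.
  by right; have [] := hC H HC; split.
have yh : alpha U ^+ m U \is (m U).-homog.
  by rewrite -[X in X.-homog]mul1n; apply/dhomogMn/linform_homog.
apply: (@euler_mult_rank2 _ _ _ _ _ _ X theta psi _ (\sum_(H <- C | (X <= H)%VS) m H)%N).
- exact: incl_trace_on.
- exact: hyperplane_cap_dim.
- by move=> H; rewrite in_fsetU => /orP [/hB|/hC] [].
- move=> H /LP [->|[HC sH hH vH]].
    apply/(in_D_form _ _ hU kU); rewrite thE u1 Uv mpolyC0 mpolyC1 mulr0 mulr1 addr0.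
    exact: rdvd_refl.
  apply/(in_D_form _ _ hH (lker_beta hH vH)); rewrite thE beta_v // mpolyC1 mulr1.
  by rewrite addrC mulrC mul_mpolyC; have := fP H HC sH; rewrite u0 subr0.
- by move=> i; rewrite mxE; apply: rpredD; apply: scale_const_der_homog.
- move=> H /LP [->|[HC sH hH vH]].
    apply/(in_D_form _ _ hU kU); rewrite psE Uv mpolyC0 mulr0; exact: rdvd0.
  apply/(in_D_form _ _ hH (lker_beta hH vH)); rewrite psE; apply: rdvdMr.
  rewrite /Q big_mkcond (big_fsetD1 H) //= sH; exact/rdvdMr/rdvd_refl.
- apply: scale_const_der_homog; rewrite /Q -big_filter -[X in X.-homog]big_filter.
  exact: prod_beta_homog.
- move=> eta etaD; have UL : U \in L by rewrite !inE UB capvSr.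
  have [h hh] := etaD U UL; pose zeta := eta - h *: theta.
  have zU : der_app zeta (linform_poly (alpha_form U)) = 0.
    rewrite der_appB der_appZ thE u1 Uv mpolyC0 mpolyC1 mulr0 mulr1 addr0.
    by rewrite -/(alpha U) hh mulrC subrr.
  have zD : in_D L m zeta.
    apply: in_DB => //; apply: in_DZ => H /LP [->|[HC sH hH vH]].
      apply/(in_D_form _ _ hU kU); rewrite thE u1 Uv mpolyC0 mpolyC1 mulr0 mulr1 addr0.
      exact: rdvd_refl.
    apply/(in_D_form _ _ hH (lker_beta hH vH)); rewrite thE beta_v // mpolyC1 mulr1.
    by rewrite addrC mulrC mul_mpolyC; have := fP H HC sH; rewrite u0 subr0.
  have [b bE] : rdvd Q (der_app zeta (linform_poly (beta v H0))).
    apply: rprime_prod_dvd; first exact: fset_uniq.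
    - by move=> H /hC [hH vH] _; apply/linform_prime/beta_neq0.
    - move=> H H' /hC [hH vH] /hC [hH' vH'] _ _ /eqP nH /rdvd_linform.
      by rewrite !lker_beta // => sH; apply/nH/hyperplane_eq.
    move=> H HC sH; have [hH vH] := hC H HC.
    have HL : H \in L by rewrite !inE HC orbT sH.
    have /(in_D_form _ _ hH (lker_beta hH vH)) := zD H HL.
    have := beta_sub h0 hH hU v0 vH vU u1 sH.
    set c : K := (_ - _ : K) => cE; rewrite [in der_app _ _]cE.
    by rewrite der_appDr (der_appZr zeta c (alpha_form U)) zU scaler0 addr0.
  exists h, b => g sg; rewrite -XE in sg.
  have : der_app zeta (linform_poly g) = b * der_app psi (linform_poly g).
    rewrite (der_decomp _ a0v u0 Uv u1 sg) zU mulr0 addr0 bE psE.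
    by rewrite mulrC -mulrA mulrCA.
  by rewrite der_appB der_appZ => <-; rewrite addrC subrK.
- move=> [eta thE']; have := thE (alpha_form U).
  rewrite u1 Uv mpolyC0 mpolyC1 mulr0 mulr1 addr0 thE' der_appZ => E.
  have := @rprime_expn _ _ _ (m U) (alpha_prime h0) (alpha_ndvd h0 hU n0).
  by apply; rewrite -E; apply/rdvdMr/rdvd_refl.
have [g gE] : rdvd (alpha H0) Q.
  rewrite -[alpha H0]expr1; apply/(dvd_form _ _ h0 k0).
  rewrite /Q big_mkcond (big_fsetD1 H0) //= capvSl; apply: rdvdMr.
  exact: rdvd_exp.
by exists (g *: const_der v); rewrite scalerA -gE.
Qed.

End EulerModular.

(** * Inductive freeness of an added block *)

Section Extensionality.
Variables (K : fieldType) (V : vectType K).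
Implicit Types (A : {fset {vspace V}}) (m : {vspace V} -> nat).

Lemma is_basis_iff k (b : 'I_k -> Der V) (D D' : Der V -> Prop) :
  (forall theta, D theta <-> D' theta) -> is_basis b D -> is_basis b D'.
Proof. by move=> DD [bD bS bF]; split=> // [i|th /DD /bS //]; apply/DD. Qed.

Lemma has_exp_iff A m A' m' e :
  (forall theta, in_D A m theta <-> in_D A' m' theta) ->
  has_exp A m e -> has_exp A' m' e.
Proof. by move=> DD [b [bb bh]]; exists b; split=> //; apply: is_basis_iff bb. Qed.

Lemma in_D_ext_iff A m m' theta : {in A, m =1 m'} -> in_D A m theta <-> in_D A m' theta.
Proof. by move=> mm; split; apply: in_D_ext => // H HA; rewrite mm. Qed.

Lemma euler_mult_ext (H0 : {vspace V}) A m m' (Y : {vspace subvs_of H0}) d :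
  {in A, m =1 m'} -> euler_mult A m Y d -> euler_mult A m' Y d.
Proof.
move=> mm [th [psi [p [e [eX bb hh nth' ps]]]]]; exists th, psi, p, e; split=> //.
apply: is_basis_iff bb => eta; apply: in_D_ext_iff => H.
by rewrite !inE => /andP [HA _]; apply: mm.
Qed.

Lemma deletion_arr_sub A m H0 : deletion_arr A m H0 `<=` A.
Proof. by rewrite /deletion_arr; case: eqP => _; [apply: fsubsetDl|apply: fsubset_refl]. Qed.

(** A hyperplane of multiplicity zero imposes no condition, so both cases of the deletion can be
    treated on A with the multiplicity lowered. *)
Lemma in_D_deletion A m H0 theta : H0 \in A ->
  in_D A (deletion_mult m H0) theta <->
  in_D (deletion_arr A m H0) (deletion_mult m H0) theta.
Proof.
move=> H0A; split; first by apply/in_D_sub/deletion_arr_sub.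
rewrite /deletion_arr; case: eqP => // m1 hD H HA.
have [->|nH] := eqVneq H H0; last by apply: hD; rewrite in_fsetD1 nH.
by rewrite /deletion_mult eqxx m1 expr0; apply: rdvd1.
Qed.

Lemma deletion_mult_gt0 A m H0 : (forall H, H \in A -> 0 < m H)%N ->
  forall H, H \in deletion_arr A m H0 -> (0 < deletion_mult m H0 H)%N.
Proof.
rewrite /deletion_arr /deletion_mult => mA H; case: eqP => m1.
  by rewrite in_fsetD1 => /andP [/negPf -> /mA].
move=> HA; case: eqP => [HE|_]; last exact: mA.
by have := mA H HA; rewrite HE; lia.
Qed.

End Extensionality.

(** Multiplicities are functions on all subspaces, and those arising from deletion and restriction
    agree with the expected ones on the arrangement only. *)
Lemma IFM_ext (K : fieldType) (V : vectType K) (A : {fset {vspace V}})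
    (m m' : {vspace V} -> nat) : IFM A m -> {in A, m =1 m'} -> IFM A m'.
Proof.
move=> hI; elim: hI m' => {V A m} [V m|V A m H0 mstar e' e'' mA H0A eul _ IHd hr _ hd he hc] m' mm.
  exact: IFM_empty.
have dE : deletion_arr A m' H0 = deletion_arr A m H0.
  by rewrite /deletion_arr mm.
have dm : {in deletion_arr A m H0, deletion_mult m H0 =1 deletion_mult m' H0}.
  move=> H /(fsubsetP (deletion_arr_sub _ _ _)) HA.
  by rewrite /deletion_mult; case: eqP => _; rewrite mm.
apply: (@IFM_step _ _ _ _ H0 mstar e' e'') => //.
- by move=> H HA; rewrite -mm //; apply: mA.
- by move=> X /eul; apply: euler_mult_ext.
- by rewrite dE; apply: IHd.
- by rewrite dE; apply: has_exp_iff hd => th; apply: in_D_ext_iff.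
Qed.

Section Pr.
Variables (K : fieldType) (V : vectType K) (v : V) (H0 : {vspace V}).
Hypotheses (h0 : hyperplane H0) (v0 : v \notin H0).

Definition pr_along : 'Hom(V, subvs_of H0) :=
  (linfun (vsproj H0) \o aproj (beta v H0) v)%VF.

Lemma pr_alongE w : incl H0 (pr_along w) = aproj (beta v H0) v w.
Proof. by rewrite inclE comp_lfunE lfunE vsprojK // aproj_beta_mem. Qed.

Lemma incl_inj : injective (incl H0).
Proof. by move=> x y; rewrite !inclE => /val_inj. Qed.

Lemma pr_alongK : (pr_along \o incl H0)%VF = \1%VF.
Proof.
apply/lfunP => x; rewrite comp_lfunE id_lfunE; apply: incl_inj.
rewrite pr_alongE aprojE; have : incl H0 x \in lker (beta v H0).
  by rewrite lker_beta // inclE subvsP.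
by rewrite memv_ker => /eqP ->; rewrite scale0r subr0.
Qed.

Lemma pr_along_v : pr_along v = 0.
Proof. by apply: incl_inj; rewrite pr_alongE aprojE beta_v // scale1r subrr linear0. Qed.

Lemma lift_trace_on (U : {vspace V}) : v \in U ->
  (pr_along @^-1: trace_on H0 U)%VS = U.
Proof.
move=> vU; apply/vspaceP => w; rewrite -memv_preim mem_trace_on -inclE pr_alongE.
apply/idP/idP => [|wU]; last exact: aproj_mem.
by rewrite aprojE rpredBr // rpredZ.
Qed.

Definition trace_arr (B : {fset {vspace V}}) : {fset {vspace subvs_of H0}} :=
  [fset trace_on H0 U | U in B].

(** Y is the trace on H0 of its preimage under the projection along v. For U in B the trace of U
    thus receives m(U), which is its Euler multiplicity by [euler_mult_modular]. *)
Definition lift_mult (m : {vspace V} -> nat) (Y : {vspace subvs_of H0}) : nat :=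
  m (pr_along @^-1: Y)%VS.

Lemma trace_arrP (B : {fset {vspace V}}) Y :
  reflect (exists2 U, U \in B & Y = trace_on H0 U) (Y \in trace_arr B).
Proof. by apply: (iffP (imfsetP _ _ _ _)) => -[U]; exists U. Qed.

Lemma hspan_trace_arr B m z :
  (forall U, U \in B -> hyperplane U /\ v \in U) ->
  hspan B m ((0%N, const_der v) :: z) ->
  exists2 z', unzip1 z' = unzip1 z & hspan (trace_arr B) (lift_mult m) z'.
Proof.
move=> hB hz; exists [seq (p.1, der_map (incl H0) pr_along p.2) | p <- z].
  by rewrite /unzip1 -map_comp; apply: eq_map.
apply: (hspan_restrict pr_alongK _ _ pr_along_v hz).
  move=> Y /trace_arrP [U UB ->]; have [hU vU] := hB U UB.
  rewrite /lift_mult lift_trace_on //; split=> //; apply: hyperplane_trace_on => //.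
  by apply: contraNneq v0 => ->.
move=> U UB; have [hU vU] := hB U UB; exists (trace_on H0 U); last by rewrite lift_trace_on.
by apply/trace_arrP; exists U.
Qed.

End Pr.

Section ModularIFM.
Variables (K : fieldType) (V : vectType K) (v : V).
Variables (B : {fset {vspace V}}).

(** Members of C contribute nothing new to the restriction: their traces on H0 are already traces of
    members of B. *)
Lemma restriction_modular C m H0 : modular_ext v B C m -> H0 \in C ->
  restriction_arr H0 (B `|` C) = trace_arr H0 B.
Proof.
move=> [hB hC hBC _] H0C; have [h0 v0] := hC H0 H0C.
have n0 U : U \in B -> H0 != U by move=> /hB [_ vU]; apply: contraNneq v0 => ->.
apply/fsetP => Y; apply/imfsetP/trace_arrP => /= -[U]; last first.
  by move=> UB ->; exists U; rewrite // in_fsetD1 eq_sym n0 // in_fsetU UB.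
rewrite in_fsetD1 in_fsetU => /andP [nU /orP [UB|UC]] ->; first by exists U.
rewrite eq_sym in nU; have [W WB sW] := hBC _ _ H0C UC nU; exists W => //.
apply/vspaceP => w; rewrite !mem_trace_on.
have wH : vsval w \in H0 by apply: subvsP.
have := cap_eq h0 (hC U UC).1 (hB W WB).1 nU (n0 W WB) sW.
move=> /vspaceP /(_ (vsval w)); rewrite !memv_cap wH /= => ->.
by [].
Qed.

Lemma IFM_modular_ext C m z : (size z).+1 = \dim {:V} ->
  modular_ext v B C m -> (forall H, H \in B `|` C -> 0 < m H)%N ->
  hspan B m ((0%N, const_der v) :: z) -> IFM B m ->
  (forall H0, H0 \in C -> IFM (trace_arr H0 B) (@lift_mult _ _ v H0 m)) ->
  IFM (B `|` C) m.
Proof.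
move=> sz; have [n] := ubnP (\sum_(H <- C) m H)%N; elim: n C m => // n IH C m.
rewrite ltnS => Cn hE mpos hz IB Itr; have [hB hC hBC _] := hE.
have [->|[H0 H0C]] := fset_0Vmem C; first by rewrite fsetU0.
have [h0 v0] := hC H0 H0C; have H0A : H0 \in B `|` C by rewrite in_fsetU H0C orbT.
have m0 := mpos _ H0A; have H0B : H0 \notin B.
  by apply: contra v0 => /hB [].
pose m' := deletion_mult m H0; pose C' := deletion_arr C m H0.
have m'B : {in B, m =1 m'}.
  by move=> U UB; rewrite /m' /deletion_mult; case: eqP H0B => // <-; rewrite UB.
have m'C H : (m' H <= m H)%N by apply: deletion_mult_le.
have CC : C' `<=` C by apply: deletion_arr_sub.
have dE : deletion_arr (B `|` C) m H0 = B `|` C'.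
  rewrite /C' /deletion_arr; case: eqP => // _; apply/fsetP => H.
  rewrite !(in_fsetU, in_fsetD1); case: eqP => //= ->.
  by rewrite (negPf H0B).
(* Here H0 is kept, possibly with multiplicity zero, to compute the exponents of the deletion; the
   version with C' serves the induction hypothesis, which asks for positive multiplicities. *)
have hE' : modular_ext v B C m'.
  by apply: modular_ext_sub hE => // U UB; rewrite m'B.
have hE'' : modular_ext v B C' m'.
  by apply: modular_ext_sub hE' => //.
have sumC : (\sum_(H <- C') m' H = \sum_(H <- C) m' H)%N.
  rewrite /C' /deletion_arr; case: eqP => // m1; rewrite [RHS](big_fsetD1 H0) //=.
  by rewrite /m' {2}/deletion_mult eqxx m1.
have m'sum : (\sum_(H <- C') m' H < \sum_(H <- C) m H)%N.
  by rewrite sumC; apply: sum_deletion_mult.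
have hz' : hspan B m' ((0%N, const_der v) :: z).
  case: hz => zD zS; split=> [p /zD [hD hh]|eta hD]; last first.
    by apply: zS; apply/(in_D_ext_iff _ m'B).
  by split=> //; apply/(in_D_ext_iff _ m'B).
have [z2 z2E hz2] := hspan_modular_ext hE' hz'.
have [z3 z3E hz3] := hspan_trace_arr h0 v0 hB hz.
have hA : forall H, H \in B `|` C -> hyperplane H.
  by move=> H; rewrite in_fsetU => /orP [/hB|/hC] [].
have lE U : U \in B -> lift_mult v m (trace_on H0 U) = m U.
  by move=> /hB [_ vU]; rewrite /lift_mult lift_trace_on.
apply: (@IFM_step _ _ _ _ H0 (lift_mult v m) (unzip1 z2) (unzip1 z3)) => //.
- by move=> H HA; split; [apply: hA|apply: mpos].
- rewrite (restriction_modular hE H0C) => X /trace_arrP [U UB ->].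
  by rewrite lE //; apply: euler_mult_modular hE _ _ _.
- rewrite dE; apply: IH => //.
  + exact: leq_trans m'sum Cn.
  + move=> H HBC; apply: (deletion_mult_gt0 mpos); rewrite dE //.
  + by apply: IFM_ext IB m'B.
  move=> H1 /(fsubsetP CC) H1C; apply: (IFM_ext (Itr H1 H1C)).
  have [h1 v1] := hC H1 H1C.
  move=> Y /trace_arrP [U UB ->]; have [hU vU] := hB U UB.
  by rewrite /lift_mult lift_trace_on // m'B.
- by rewrite (restriction_modular hE H0C); apply: Itr.
- apply: (@has_exp_iff _ _ (B `|` C) m'); first by move=> th; apply: in_D_deletion.
  apply: hspan_has_exp => //; rewrite -sz.
  by rewrite -(size_map fst z2) -/(unzip1 z2) z2E /= size_map.
- rewrite (restriction_modular hE H0C); apply: hspan_has_exp => //.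
    move=> Y /trace_arrP [U UB ->]; apply: hyperplane_trace_on => //; first by have [] := hB U UB.
    by apply: contraNneq H0B => ->.
  rewrite -(size_map fst z3) -/(unzip1 z3) z3E size_map dimvf /dim /=.
  by apply/eqP; rewrite -eqSS sz h0.
by move=> d; rewrite z2E z3E /= leq_addl.
Qed.

End ModularIFM.

Section RankOne.
Variables (K : fieldType) (V : vectType K).

Lemma hspan_empty (m : {vspace V} -> nat) :
  hspan fset0 m [seq (0%N, const_der w) | w <- vbasis {:V}].
Proof.
split=> [p /mapP [w _ ->]|eta _]; first by split=> // i; apply: const_der_homog0.
rewrite /unzip2 -map_comp; apply: (lc_const_der (vbasisP {:V})) => f sf.
have -> : f = 0.
  apply/lfunP => w; rewrite zero_lfunE; apply/eqP; rewrite -memv_ker.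
  exact/(subvP sf)/memvf.
by rewrite der_app_linform big1 // => i _; rewrite zero_lfunE scale0r.
Qed.

Lemma unzip1_zeros (s : seq V) :
  unzip1 [seq (0%N, const_der w) | w <- s] = nseq (size s) 0%N.
Proof. by elim: s => //= w s ->. Qed.

(** The modular step with B empty and C = {Y}. *)
Lemma rank_one_IFM (Y : {vspace V}) (m : {vspace V} -> nat) : hyperplane Y ->
  (0 < m Y)%N ->
  IFM [fset Y] m /\ has_exp [fset Y] m (m Y :: nseq (\dim {:V}).-1 0%N).
Proof.
move=> hY mY; have [v vY] : exists v, v \notin Y.
  have [v v1] := form_neq0 (alpha_form_neq0 hY); exists v.
  by rewrite -(lker_alpha_form hY) memv_ker v1 oner_eq0.
have v0 : v != 0 by apply: contraNneq vY => ->; apply: mem0v.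
have hE : modular_ext v fset0 [fset Y] m.
  split=> // [H|H H']; rewrite ?inE; first by move=> /eqP ->.
  by move=> /eqP -> /eqP ->; rewrite eqxx.
have [z' pz hz] : exists2 z', perm_eq (unzip1 [seq (0%N, const_der w) | w <- vbasis {:V}])
    (0%N :: unzip1 z') & hspan fset0 m ((0%N, const_der v) :: z').
  by apply: hspan_exchange (hspan_empty m).
have sz : (size z').+1 = \dim {:V}.
  have := perm_size pz; rewrite unzip1_zeros size_nseq size_tuple => ->.
  by rewrite /= size_map.
have [z2 z2E hz2] := hspan_modular_ext hE hz.
rewrite fset0U in hz2.
have hA : forall H, H \in [fset Y] -> hyperplane H by move=> H; rewrite inE => /eqP ->.
split.
  rewrite -[[fset Y]]fset0U; apply: (IFM_modular_ext sz hE) => //.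
  - by move=> H; rewrite !inE => /eqP ->.
  - exact: IFM_empty.
  by move=> H0 _; rewrite /trace_arr imfset0; apply: IFM_empty.
have z'0 : perm_eq (unzip1 z') (nseq (\dim {:V}).-1 0%N).
  rewrite -(perm_cons 0%N) -(permPl pz) unzip1_zeros size_tuple.
  by rewrite -[\dim _]sz /=.
apply: (@has_exp_perm _ _ _ _ hA (unzip1 z2)).
- by rewrite z2E /= size_map.
- by rewrite z2E /mult_size big_seq_fset1 perm_cons.
by apply: hspan_has_exp => //; rewrite -sz -(size_map fst z2) -/(unzip1 z2) z2E /= size_map.
Qed.

End RankOne.

(** * Rank two *)

Section RankTwoBasis.
Variables (K : fieldType) (V : vectType K) (X : {vspace V}).
Hypothesis dX : (\dim X).+2 = \dim {:V}.
Implicit Types (H U : {vspace V}) (p q h : symalg V) (f a y : 'Hom(V, K^o)).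

(* That is, p lies in Sym((V/X)^* ), expressed without choosing a complement of X. *)
Definition invariant_along p : Prop :=
  forall phi : 'End(V), (forall w, phi w - w \in X) -> pull phi p = p.

Lemma inv_linform f : (X <= lker f)%VS -> invariant_along (linform_poly f).
Proof.
move=> sf phi hphi; rewrite pull_linform; congr linform_poly; apply/lfunP => w.
have : phi w - w \in lker f by apply: (subvP sf).
by rewrite memv_ker linearB subr_eq0 comp_lfunE => /eqP.
Qed.

Lemma invC c : invariant_along c%:MP.
Proof. by move=> phi _; rewrite pullC. Qed.

Lemma inv0 : invariant_along 0.
Proof. by move=> phi _; rewrite raddf0. Qed.

Lemma invD p q : invariant_along p -> invariant_along q -> invariant_along (p + q).
Proof. by move=> hp hq phi h; rewrite raddfD /= hp // hq. Qed.

Lemma invB p q : invariant_along p -> invariant_along q -> invariant_along (p - q).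
Proof. by move=> hp hq phi h; rewrite raddfB /= hp // hq. Qed.

Lemma invM p q : invariant_along p -> invariant_along q -> invariant_along (p * q).
Proof. by move=> hp hq phi h; rewrite rmorphM /= hp // hq. Qed.

Lemma invX p k : invariant_along p -> invariant_along (p ^+ k).
Proof. by move=> hp phi h; rewrite rmorphXn /= hp. Qed.

Lemma inv_mulI a p : a != 0 -> (X <= lker a)%VS ->
  invariant_along (linform_poly a * p) -> invariant_along p.
Proof.
move=> a0 sa hap phi h; apply: (@mulfI _ (linform_poly a)).
  by rewrite linform_eq0.
by rewrite -{1}(inv_linform sa h) -rmorphM /= (hap _ h).
Qed.

Lemma inv_mulI_exp a k p : a != 0 -> (X <= lker a)%VS ->
  invariant_along (linform_poly a ^+ k * p) -> invariant_along p.
Proof.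
move=> a0 sa; elim: k => [|k IH]; first by rewrite expr0 mul1r.
by rewrite exprS -mulrA => /(inv_mulI a0 sa).
Qed.

Lemma pull_outer y (u : V) h n : h \is n.-homog ->
  exists c : K, pull (outer y u) h = c *: linform_poly y ^+ n.
Proof.
move=> /dhomogP hh; rewrite [h]mpolyE raddf_sum big_seq.
elim/big_rec: _ => [|k p kh [c ->]]; first by exists 0; rewrite scale0r.
suff [d dE] : exists d : K, pull (outer y u) 'X_[k] = d *: linform_poly y ^+ n.
  by exists (h@_k * d + c); rewrite /= pullZ dE scalerA scalerDl.
rewrite -(hh k kh) mpolyXE_id rmorph_prod /= mdegE.
elim/big_rec2: _ => [|i d q _ [c' ->]]; first by exists 1; rewrite expr0 scale1r.
rewrite rmorphXn /= pull_crd; have -> : (crd i \o outer y u)%VF = (crd i u : K) *: y.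
  by apply/lfunP => w; rewrite comp_lfunE outerE form_scale scale_lfunE mulrC.
rewrite linearZ /= exprZn; exists ((crd i u : K) ^+ k i * c').
by rewrite exprD -scalerAl -scalerAr scalerA.
Qed.

(** On the plane V/X the line a = 0 has the single coordinate y, so a binary form of degree n
    reduces modulo a to a multiple of y^n. The map [outer y u + outer a v] is the identity modulo X,
    hence fixes h; followed by the reduction it factors through y alone. *)
Lemma inv_restrict a y (u v : V) h n : a v = 1 -> a u = 0 -> y v = 0 -> y u = 1 ->
  (lker a :&: lker y = X)%VS -> invariant_along h -> h \is n.-homog ->
  exists c : K, pull (aproj a v) h = c *: linform_poly y ^+ n.
Proof.
move=> av au yv yu XE hinv hh; have [c cE] := pull_outer y u hh; exists c.
rewrite -cE -{1}(hinv (outer y u + outer a v)) => [|w].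
  rewrite pull_comp; congr pull; apply/lfunP => w.
  rewrite comp_lfunE add_lfunE !outerE aproj_ker // scale0r addr0.
  by rewrite form_aproj yv mulr0 subr0.
rewrite -XE memv_cap !memv_ker !linearB /= !add_lfunE !outerE !linearD /= !form_scale.
by rewrite av au yv yu !mulr1 !mulr0 add0r addr0 !subrr !eqxx.
Qed.

Lemma hyperplane_addv v : v \notin X -> hyperplane (X + <[v]>)%VS.
Proof.
move=> vX; rewrite /hyperplane -dX dimv_disjoint_sum ?dim_vline.
  by rewrite (contraNneq _ vX) ?addn1 // => ->; apply: mem0v.
apply/eqP; rewrite -subv0; apply/subvP => w; rewrite memv_cap => /andP [wX].
case/vlineP => c wE; rewrite memv0 wE; apply: contraNT vX => cv.
have c0 : c != 0 by apply: contraNneq cv => ->; rewrite scale0r.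
by rewrite -[v]scale1r -(mulVf c0) -scalerA -wE rpredZ.
Qed.

Lemma codim2_coords H0 : hyperplane H0 -> (X <= H0)%VS ->
  exists y u v, [/\ v \notin H0, beta v H0 u = 0, y v = 0, y u = 1
    & (lker (beta v H0) :&: lker y = X)%VS].
Proof.
move=> h0 sX; have [v v1] := form_neq0 (alpha_form_neq0 h0).
have v0 : v \notin H0 by rewrite -(lker_alpha_form h0) memv_ker v1 oner_eq0.
have vX : v \notin X by apply: contra v0; apply: (subvP sX).
pose U := (X + <[v]>)%VS.
have hU : hyperplane U by apply: hyperplane_addv.
have vU : v \in U by rewrite -[v]add0r memv_add ?mem0v ?memv_line.
have n0 : H0 != U by apply: contraNneq v0 => ->.
have [u0 u1] := form_neq0 (alpha_form_neq0 hU).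
have yv : alpha_form U v = 0 by apply/eqP; rewrite -memv_ker lker_alpha_form.
exists (alpha_form U), (aproj (beta v H0) v u0), v; split=> //.
- by rewrite aproj_ker ?beta_v.
- by rewrite form_aproj u1 yv mulr0 subr0.
rewrite lker_beta // lker_alpha_form //; apply/esym/eqP.
rewrite eqEdim subv_cap sX addvSl /=.
by rewrite -2!ltnS (hyperplane_cap_dim h0 hU n0) dX.
Qed.

Variable A : {fset {vspace V}}.
Hypothesis hA : forall H, H \in A -> hyperplane H /\ (X <= H)%VS.
Implicit Types (m : {vspace V} -> nat) (theta psi eta : Der V).

Definition good_der m theta d : Prop :=
  [/\ forall i, invariant_along (theta 0 i), forall i, theta 0 i \is d.-homog
    & in_D A m theta].

(** Spanning modulo the derivations along X: values are compared only on forms that vanish on X. The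
    constants along X are put back by [hspan_rank2]. *)
Definition rank2_spans m theta psi : Prop :=
  forall eta, in_D A m eta -> exists b c, forall f, (X <= lker f)%VS ->
    der_app eta (linform_poly f) = b * der_app theta (linform_poly f) +
                                   c * der_app psi (linform_poly f).

Lemma rank2_spans_sym m theta psi : rank2_spans m theta psi -> rank2_spans m psi theta.
Proof.
by move=> hS eta /hS [b [c E]]; exists c, b => f /E ->; rewrite addrC.
Qed.

Lemma inv_der_app theta f : (forall i, invariant_along (theta 0 i)) ->
  invariant_along (der_app theta (linform_poly f)).
Proof.
move=> h; rewrite der_app_linform; elim/big_rec: _ => [|i p _ hp]; first exact: inv0.
by apply: invD => //; rewrite -mul_mpolyC; apply: invM => //; apply: invC.
Qed.

Section Step.
Variables (m : {vspace V} -> nat) (H0 : {vspace V}).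
Hypotheses (H0A : H0 \in A) (m0 : (0 < m H0)%N).
Let m' := deletion_mult m H0.

Let h0 : hyperplane H0 := (hA H0A).1.
Let sX0 : (X <= H0)%VS := (hA H0A).2.

Lemma in_D_step theta v g : v \notin H0 -> in_D A m' theta ->
  der_app theta (linform_poly (beta v H0)) =
    linform_poly (beta v H0) ^+ (m H0).-1 * g ->
  in_D A m theta <-> rdvd (linform_poly (beta v H0)) g.
Proof.
move=> v0 hD gE; have k0 := lker_beta h0 v0.
have t0 : linform_poly (beta v H0) ^+ (m H0).-1 != 0.
  by rewrite expf_neq0 // linform_eq0 beta_neq0.
split=> [/(_ _ H0A) /(in_D_form _ _ h0 k0)|hg H HA].
  by rewrite gE -{1}(prednK m0) exprSr => /(rdvd_mulIl t0).
have [HE|nH] := eqVneq H H0; last first.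
  by have := hD H HA; rewrite /m' /deletion_mult (negPf nH).
rewrite HE; apply/(in_D_form _ _ h0 k0); rewrite gE -{1}(prednK m0) exprSr.
by apply: rdvdM => //; apply: rdvd_refl.
Qed.

Let Q0 := \prod_(U <- A `\ H0) alpha U ^+ m U.

Lemma Q0_ndvd : ~ rdvd (alpha H0) Q0.
Proof.
rewrite /Q0 big_seq; apply: rprime_prod => [|U]; first exact: alpha_prime.
rewrite in_fsetD1 eq_sym => /andP [nU /hA [hU _]].
by apply: rprime_expn; [apply: alpha_prime|apply: alpha_ndvd].
Qed.

Lemma in_D_Q0 p w : rdvd (alpha H0 ^+ m H0) (p * (alpha_form H0 w : K)%:MP) ->
  in_D A m ((Q0 * p) *: const_der w).
Proof.
move=> hp H HA; rewrite der_appZ der_app_const.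
have [->|nH] := eqVneq H H0; first by rewrite -mulrA; apply: rdvdMl.
apply/rdvdMr/rdvdMr; rewrite /Q0 (big_fsetD1 H) ?in_fsetD1 ?nH //=.
exact/rdvdMr/rdvd_refl.
Qed.

(** Bases of D(A, m) and of its deletion, modulo derivations along X, that differ by the factor
    alpha_H0 in one member. The last clause makes the degree of theta the Euler multiplicity. *)
Definition step_spec theta psi (d p : nat) : Prop :=
  [/\ good_der m theta d, good_der m' psi p, rank2_spans m theta (alpha H0 *: psi),
      rank2_spans m' theta psi
    & exists2 y, (X <= lker y)%VS & ~ rdvd (alpha H0) (der_app theta (linform_poly y))].

(** Since [h1] is prime to beta_H0, a combination of theta - q psi and psi lies in D(A, m) exactly
    when the coefficient of psi is divisible by alpha_H0. *)
Lemma pivot_step theta psi (d p : nat) (y : 'Hom(V, K^o)) (u v : V) h1 h2 q :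
  v \notin H0 -> beta v H0 u = 0 -> y u = 1 -> (X <= lker y)%VS ->
  good_der m' psi p -> good_der m' theta d ->
  rank2_spans m' psi theta ->
  der_app psi (linform_poly (beta v H0)) =
    linform_poly (beta v H0) ^+ (m H0).-1 * h1 ->
  der_app theta (linform_poly (beta v H0)) =
    linform_poly (beta v H0) ^+ (m H0).-1 * h2 ->
  ~ rdvd (linform_poly (beta v H0)) h1 ->
  rdvd (linform_poly (beta v H0)) (h2 - q * h1) ->
  invariant_along q -> (forall i, (q *: psi) 0 i \is d.-homog) ->
  step_spec (theta - q *: psi) psi d p.
Proof.
move=> v0 u0 yu sy [psI psh psD] [thI thh thD] hS h1E h2E n1 d2 qI qh.
set th := theta - q *: psi.
have thE : der_app th (linform_poly (beta v H0)) =
    linform_poly (beta v H0) ^+ (m H0).-1 * (h2 - q * h1).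
  by rewrite der_appB der_appZ h1E h2E mulrBr [in RHS]mulrCA.
have thD' : in_D A m' th by apply/in_DB/in_DZ.
have thDm : in_D A m th by apply/(in_D_step v0 thD' thE).
have hS' : rank2_spans m' th psi.
  move=> eta /hS [b [c E]]; exists c, (b + c * q) => f sf.
  by rewrite E // der_appB der_appZ; ring.
have hSm : rank2_spans m th (alpha H0 *: psi).
  move=> eta etaD; have [b [c E]] := hS' eta (in_D_deletion_mult H0 etaD).
  have sb : (X <= lker (beta v H0))%VS by rewrite lker_beta.
  have etaE : der_app eta (linform_poly (beta v H0)) =
      linform_poly (beta v H0) ^+ (m H0).-1 * (b * (h2 - q * h1) + c * h1).
    by rewrite E // thE h1E; ring.
  have /(in_D_step v0 (in_D_deletion_mult H0 etaD) etaE) hd := etaD.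
  have : rdvd (linform_poly (beta v H0)) (c * h1).
    rewrite -[c * h1](addKr (b * (h2 - q * h1))) addrC; apply: rdvdB => //.
    exact: rdvdMl.
  have [_ _ bP] := linform_prime (beta_neq0 h0 v0).
  case/bP => // hc; have [c' c'E] : rdvd (alpha H0) c.
    by rewrite -[alpha H0]expr1; apply/(dvd_form _ _ h0 (lker_beta h0 v0)).
  exists b, c' => f sf; rewrite E // der_appZ c'E; ring.
split=> //.
  split=> // i; rewrite mxE [X in _ + X]mxE; last by apply: rpredB; [apply: thh|apply: qh].
  by apply: invB; [apply: thI|rewrite mxE; apply: invM; [|apply: psI]].
exists y => // hd; apply: Q0_ndvd.
(* As u lies in H0, this derivation satisfies the condition at H0. Its value Q0 on y would be
   divisible by alpha_H0 if the value of theta - q psi were. *)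
have Qu : in_D A m ((Q0 * 1) *: const_der u).
  apply: in_D_Q0; have : u \in H0 by rewrite -(lker_beta h0 v0) memv_ker u0.
  rewrite -{1}(lker_alpha_form h0) memv_ker => /eqP ->.
  by rewrite mulr0; apply: rdvd0.
have [b [c /(_ y sy)]] := hSm _ Qu.
rewrite !der_appZ der_app_const yu mpolyC1 !mulr1 => ->.
by apply: rdvdD; apply: rdvdMl => //; apply/rdvdMr/rdvd_refl.
Qed.

(** The two cofactors reduce modulo H0 to multiples of powers of the same form y, so one reduction
    divides the other and elimination never needs more than one step. *)
Lemma rank2_step theta1 theta2 d1 d2 :
  good_der m' theta1 d1 -> good_der m' theta2 d2 -> rank2_spans m' theta1 theta2 ->
  exists theta psi d (p : nat), step_spec theta psi d p.
Proof.
move=> g1 g2 hS; have [y [u [v [v0 u0 yv yu XE]]]] := codim2_coords h0 sX0.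
have a0v := beta_v h0 v0; have k0 := lker_beta h0 v0.
have sy : (X <= lker y)%VS by rewrite -XE capvSr.
have sb : (X <= lker (beta v H0))%VS by rewrite k0.
set t := linform_poly (beta v H0); have t0 : t ^+ (m H0).-1 != 0.
  by rewrite expf_neq0 // linform_eq0 beta_neq0.
have th : t ^+ (m H0).-1 \is (m H0).-1.-homog.
  by rewrite -[X in X.-homog]mul1n; apply/dhomogMn/linform_homog.
have key theta d : good_der m' theta d ->
  exists h c n, [/\ der_app theta t = t ^+ (m H0).-1 * h,
    pull (aproj (beta v H0) v) h = c *: linform_poly y ^+ n &
    c != 0 -> d = ((m H0).-1 + n)%N].
  move=> [thI thh thD].
  have [h hE] : rdvd (t ^+ (m H0).-1) (der_app theta t).
    by have /(in_D_form _ _ h0 k0) := thD H0 H0A; rewrite /m' /deletion_mult eqxx.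
  have [hz|hnz] := eqVneq h 0.
    by exists h, 0, 0%N; split; rewrite ?eqxx // hz raddf0 scale0r.
  have hh : t ^+ (m H0).-1 * h \is d.-homog by rewrite -hE; apply: der_app_homog.
  have [kd hh'] := homog_quot t0 th hh hnz.
  have hI : invariant_along h.
    apply: (inv_mulI_exp (beta_neq0 h0 v0) sb (k := (m H0).-1)).
    by rewrite -/t -hE; apply: inv_der_app.
  have [c cE] := inv_restrict a0v u0 yv yu XE hI hh'.
  by exists h, c, (d - (m H0).-1)%N; split=> // _; rewrite subnKC.
have [h1 [c1 [n1 [h1E r1 e1]]]] := key _ _ g1.
have [h2 [c2 [n2 [h2E r2 e2]]]] := key _ _ g2.
have yn0 n : linform_poly y ^+ n != 0.
  rewrite expf_neq0 // linform_eq0; apply: contraTneq (oner_neq0 K) => y0.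
  by rewrite -[1]/(1 : K^o) -yu y0 zero_lfunE eqxx.
have ndvd h c n : c != 0 -> pull (aproj (beta v H0) v) h = c *: linform_poly y ^+ n ->
    ~ rdvd t h.
  move=> c0 hc /(rdvd_aproj _ a0v) /eqP; rewrite hc.
  by rewrite -mul_mpolyC mulf_eq0 mpolyC_eq0 (negPf c0) (negPf (yn0 n)).
have rhoy : pull (aproj (beta v H0) v) (linform_poly y) = linform_poly y.
  rewrite pull_linform; congr linform_poly; apply/lfunP => w.
  by rewrite comp_lfunE form_aproj yv mulr0 subr0.
(* The pivot is the derivation of smaller degree among those not already in D(A, m). *)
have piv psi theta (p d : nat) h h' (c c' : K) (n n' : nat) :
    good_der m' psi p -> good_der m' theta d ->
    rank2_spans m' psi theta -> der_app psi t = t ^+ (m H0).-1 * h ->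
    der_app theta t = t ^+ (m H0).-1 * h' ->
    pull (aproj (beta v H0) v) h = c *: linform_poly y ^+ n ->
    pull (aproj (beta v H0) v) h' = c' *: linform_poly y ^+ n' ->
    (c != 0 -> p = ((m H0).-1 + n)%N) -> (c' != 0 -> d = ((m H0).-1 + n')%N) ->
    c != 0 -> c' = 0 \/ (n <= n')%N -> exists theta psi d (p : nat), step_spec theta psi d p.
  move=> gp gt hS' hE h'E hr h'r ep et c0 hc.
  have cu : c^-1 * c = 1 by rewrite mulVf.
  (* Chosen so that q h and h' have the same reduction modulo H0. The truncated n' - n does no harm
     when n exceeds n', since then c' = 0 and q = 0. *)
  pose q := (c' * c^-1) *: linform_poly y ^+ (n' - n).
  exists (theta - q *: psi), psi, d, p.
  apply: (@pivot_step theta psi d p y u v h h' q) => //; first exact: ndvd hr.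
  - apply/(rdvd_aproj _ a0v); rewrite raddfB /= rmorphM /= hr h'r.
    rewrite /q pullZ rmorphXn /= rhoy -scalerAl -scalerAr scalerA -mulrA cu mulr1.
    case: hc => [->|nn]; first by rewrite !scale0r subrr.
    by rewrite -exprD subnK // subrr.
  - rewrite /q -mul_mpolyC; apply: invM; first exact: invC.
    by apply: invX; apply: inv_linform.
  move=> i; rewrite mxE /q; have [->|c'0] := eqVneq c' 0.
    by rewrite mul0r scale0r mul0r; apply: dhomog0.
  case: hc => [c'E|nn]; first by rewrite c'E eqxx in c'0.
  rewrite (et c'0) -scalerAl; apply: rpredZ.
  have -> : ((m H0).-1 + n' = (1 * (n' - n)) + p)%N by rewrite (ep c0); lia.
  apply: dhomogM; first exact/dhomogMn/linform_homog.
  by case: gp.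
have [c10|c10] := eqVneq c1 0; have [c20|c20] := eqVneq c2 0.
(* If both reductions vanished, D(A, m') would be contained in D(A, m). The derivation Q0 t^(m(H0) -
   1) d/dv lies in the former but not in the latter. *)
- exfalso; apply: Q0_ndvd.
  have Qv : in_D A m' ((Q0 * t ^+ (m H0).-1) *: const_der v).
    move=> H HA; rewrite der_appZ der_app_const /m' /deletion_mult.
    have [->|nH] := eqVneq H H0.
      by apply/(dvd_form _ _ h0 k0)/rdvdMr/rdvdMl/rdvd_refl.
    apply/rdvdMr/rdvdMr; rewrite /Q0 (big_fsetD1 H) ?in_fsetD1 ?nH //=.
    exact/rdvdMr/rdvd_refl.
  have [b [c /(_ _ sb)]] := hS _ Qv.
  rewrite der_appZ der_app_const a0v mpolyC1 mulr1 -/t h1E h2E => E.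
  have QE : Q0 = b * h1 + c * h2.
    by apply: (mulfI t0); rewrite mulrC E mulrDr !(mulrCA (t ^+ _)).
  rewrite QE -[alpha H0]expr1; apply/(dvd_form _ _ h0 k0); rewrite expr1.
  by apply: rdvdD; apply: rdvdMl; apply/(rdvd_aproj _ a0v);
    rewrite ?r1 ?r2 ?c10 ?c20 scale0r.
- apply: (piv _ _ _ _ _ _ _ _ _ _ g2 g1 (rank2_spans_sym hS) h2E h1E r2 r1 e2 e1 c20).
  by left.
- apply: (piv _ _ _ _ _ _ _ _ _ _ g1 g2 hS h1E h2E r1 r2 e1 e2 c10).
  by left.
have [nn|nn] := leqP n1 n2.
  by apply: (piv _ _ _ _ _ _ _ _ _ _ g1 g2 hS h1E h2E r1 r2 e1 e2 c10); right.
apply: (piv _ _ _ _ _ _ _ _ _ _ g2 g1 (rank2_spans_sym hS) h2E h1E r2 r1 e2 e1 c20).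
by right; apply: ltnW.
Qed.

End Step.
End RankTwoBasis.

Section RankTwoBasisExists.
Variables (K : fieldType) (V : vectType K) (X : {vspace V}).
Hypothesis dX : (\dim X).+2 = \dim {:V}.
Variable A : {fset {vspace V}}.
Hypothesis hA : forall H, H \in A -> hyperplane H /\ (X <= H)%VS.
Implicit Types (m : {vspace V} -> nat).

Lemma in_D_alpha_scale m H0 psi : H0 \in A -> (0 < m H0)%N ->
  in_D A (deletion_mult m H0) psi -> in_D A m (alpha H0 *: psi).
Proof.
move=> H0A m0 hD H HA; rewrite der_appZ; have := hD H HA; rewrite /deletion_mult.
case: eqP => [->|_] h; last exact: rdvdMl.
by rewrite -{1}(prednK m0) exprS; apply: rdvdM => //; apply: rdvd_refl.
Qed.

Lemma alpha_scale_homog H (psi : Der V) p : (forall i, psi 0 i \is p.-homog) ->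
  forall i, (alpha H *: psi) 0 i \is p.+1.-homog.
Proof.
by move=> ph i; rewrite mxE; apply: (dhomogM (linform_homog _) (ph i)).
Qed.

(** Induction from the zero multiplicity, where all derivations are allowed; A stays fixed because
    multiplicities may vanish on it. *)
Lemma rank2_basis m : exists theta psi d p,
  [/\ good_der X A m theta d, good_der X A m psi p & rank2_spans X A m theta psi].
Proof.
have [n] := ubnP (\sum_(H <- A) m H)%N; elim: n m => // n IH m.
rewrite ltnS => An.
have [/hasP [H0 H0A m0]|/hasPn m0] := boolP (has (fun H => 0 < m H)%N A).
  pose m' := deletion_mult m H0.
  have [th1 [th2 [d1 [d2 [g1 g2 hS]]]]] := IH m' (leq_trans (sum_deletion_mult H0A m0) An).
  have [theta [psi [d [p [gt [psI psh psD] hS1 _ _]]]]] :=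
    rank2_step dX hA H0A m0 g1 g2 hS.
  exists theta, (alpha H0 *: psi), d, p.+1; split=> //; split=> [i|i|].
  - rewrite mxE; apply: invM; last exact: psI.
    by apply: inv_linform; rewrite lker_alpha_form; case: (hA H0A).
  - exact: alpha_scale_homog.
  exact: in_D_alpha_scale.
have nX : ~~ ({:V} <= X)%VS.
  by apply/negP => /dimvS; rewrite -dX; lia.
have [w _ wX] := subvPn nX; have hU := hyperplane_addv dX wX.
have [y [u [v [v0 u0 yv yu XE]]]] := codim2_coords dX hU (addvSl _ _).
have gD x : good_der X A m (const_der x) 0.
  split=> [i|i|H HA]; first by rewrite mxE; apply: invC.
    exact: const_der_homog0.
  have /eqP -> : m H == 0%N by rewrite -leqn0 leqNgt m0.
  by rewrite expr0; apply: rdvd1.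
exists (const_der u), (const_der v), 0%N, 0%N; split=> // eta _.
exists (der_app eta (linform_poly y)),
  (der_app eta (linform_poly (beta v (X + <[w]>)%VS))) => f sf.
rewrite !der_app_const; rewrite -XE in sf.
rewrite (der_decomp _ (beta_v hU v0) u0 yv yu sf) addrC.
by congr (_ + _); rewrite mulrC.
Qed.

End RankTwoBasisExists.

(** The space X is fixed while members of A are deleted, so A may drop below rank two. With at least
    two members, the restriction to H0 has X as its only member, of multiplicity deg theta, and the
    deletion has exponents deg theta, deg psi and zeros. *)
Lemma rank2_IFM (K : fieldType) (V : vectType K) (X : {vspace V})
    (A : {fset {vspace V}}) (m : {vspace V} -> nat) :
  (\dim X).+2 = \dim {:V} -> (forall H, H \in A -> hyperplane H /\ (X <= H)%VS) ->
  (forall H, H \in A -> 0 < m H)%N -> IFM A m.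
Proof.
move=> dX; have [n] := ubnP (\sum_(H <- A) m H)%N.
elim: n A m => // n IH A m; rewrite ltnS => An hA mpos.
have [->|[H0 H0A]] := fset_0Vmem A; first exact: IFM_empty.
have [h0 sX0] := hA _ H0A; have m0 := mpos H0 H0A.
have [A0|[H1]] := fset_0Vmem (A `\ H0).
  have -> : A = [fset H0] by rewrite -(fsetD1K H0A) A0 fsetU0.
  by have [] := rank_one_IFM h0 m0.
rewrite in_fsetD1 => /andP [n1 H1A]; have [h1 sX1] := hA _ H1A.
pose m' := deletion_mult m H0.
have [th1 [th2 [d1 [d2 [g1 g2 hS]]]]] := rank2_basis dX hA m'.
have [theta [psi [d [p [[thI thh thD] [psI psh psD] hS1 hS2 [y sy ny]]]]]] :=
  rank2_step dX hA H0A m0 g1 g2 hS.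
have capX U : U \in A -> U != H0 -> (H0 :&: U = X)%VS.
  move=> UA nU; have [hU sU] := hA _ UA; apply/esym/eqP.
  rewrite eqEdim subv_cap sX0 sU /= -2!ltnS dX.
  by rewrite (hyperplane_cap_dim h0 hU) // eq_sym.
(* The multiplicity on the restriction must be positive. A theta of degree zero would kill the
   equations of H0 and H1, hence every form vanishing on X, against the choice of y. *)
have d_gt0 : (0 < d)%N.
  rewrite lt0n; apply/eqP => d0.
  have thA U : U \in A -> der_app theta (alpha U) = 0.
    move=> UA; have [hU _] := hA _ UA.
    have hh : der_app theta (alpha U) \is 0.-homog.
      by have := der_app_homog (alpha_form U) thh; rewrite d0.
    have [g gE] := thD U UA; rewrite -(pihomog_dE hh) gE.
    apply: (@pihomogMl_lt _ _ (1 * m U)); first exact/dhomogMn/linform_homog.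
    by rewrite mul1n mpos.
  apply: ny; have [v [v0 v1]] : exists v, v \notin H0 /\ v \in H1.
    have nS : ~~ (H1 <= H0)%VS by apply: contra n1 => /hyperplane_eq ->.
    by have [v vH1 vH0] := subvPn nS; exists v.
  have [u1 u1E] := form_neq0 (alpha_form_neq0 h1).
  have yv : alpha_form H1 v = 0 by apply/eqP; rewrite -memv_ker lker_alpha_form.
  pose u := aproj (beta v H0) v u1.
  have u0 : beta v H0 u = 0 by rewrite aproj_ker ?beta_v.
  have yu : alpha_form H1 u = 1 by rewrite form_aproj u1E yv mulr0 subr0.
  have sy' : (lker (beta v H0) :&: lker (alpha_form H1) <= lker y)%VS.
    by rewrite lker_beta // lker_alpha_form // capX.
  rewrite (der_decomp _ (beta_v h0 v0) u0 yv yu sy') -/(alpha H1) thA // mulr0 addr0.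
  rewrite /beta der_appZr -/(alpha H0) thA // scaler0 mulr0; exact: rdvd0.
pose Y := trace_on H0 X.
have n0 : H0 != H1 by rewrite eq_sym.
have trE U : U \in A -> U != H0 -> trace_on H0 U = Y.
  move=> UA nU; rewrite /Y -(capX U UA nU); apply/vspaceP => w.
  by rewrite !mem_trace_on memv_cap subvsP.
have resE : restriction_arr H0 A = [fset Y].
  apply/fsetP => Z; rewrite inE; apply/imfsetP/eqP => /= [[U]|->].
    by rewrite in_fsetD1 => /andP [nU UA] ->; apply: trE.
  by exists H1; rewrite ?trE // in_fsetD1 n1.
have hY : hyperplane Y by rewrite -(trE H1) //; apply: hyperplane_trace_on.
have [IY eY] := @rank_one_IFM _ _ Y (fun=> d) hY d_gt0.
have dA : forall H, H \in deletion_arr A m H0 -> hyperplane H /\ (X <= H)%VS.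
  by move=> H /(fsubsetP (deletion_arr_sub _ _ _)) /hA.
have hz := hspan_rank2 hA (vbasisP X) (in_D_deletion_mult H0 thD) thh psD psh hS2.
apply: (@IFM_step _ _ _ _ H0 (fun=> d)
   [:: d, p & nseq (\dim X) 0%N] (d :: nseq (\dim {:subvs_of H0}).-1 0%N)) => //.
- by move=> H HA; split; [case: (hA _ HA)|apply: mpos].
- move=> Z; rewrite resE inE => /eqP ->.
  have locE : localization A X = A.
    by apply/fsetP => H; rewrite !inE andb_idr // => /hA [].
  apply: (@euler_mult_rank2 _ _ _ _ _ _ X theta (alpha H0 *: psi) d p.+1) => //.
  + rewrite incl_trace_on; apply/capv_idPr; exact: sX0.
  + by move=> H /hA [].
  + by rewrite locE.
  + by rewrite locE; apply: in_D_alpha_scale.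
  + exact: alpha_scale_homog.
  + by rewrite locE.
  + move=> [eta thE]; apply: ny; rewrite thE der_appZ.
    exact/rdvdMr/rdvd_refl.
  by exists psi.
- apply: IH => //; last exact: deletion_mult_gt0.
  apply: leq_trans An; rewrite /deletion_arr.
  apply: leq_ltn_trans (sum_deletion_mult H0A m0); case: ifP => // _.
  by rewrite [leqRHS](big_fsetD1 H0) //= leq_addl.
- by rewrite resE.
- apply: (@has_exp_iff _ _ A m'); first by move=> th; apply: in_D_deletion.
  have := hspan_has_exp (fun H HA => (hA _ HA).1) _ hz.
  rewrite /= unzip1_zeros size_tuple; apply.
  by rewrite size_map size_tuple.
- by rewrite resE.
have -> : (\dim {:subvs_of H0}).-1 = \dim X.
  by move: hY; rewrite /hyperplane dim_trace_on (capv_idPr sX0) => <-.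
by move=> d' /=; rewrite leq_add2l leq_addl.
Qed.

(** * Supersolvable filtrations *)

Section Center.
Variables (K : fieldType) (V : vectType K).
Implicit Types (A B : {fset {vspace V}}) (m : {vspace V} -> nat).

Definition center A : {vspace V} := (\bigcap_(H <- A) H)%VS.

Lemma mem_center A w : reflect (forall H, H \in A -> w \in H) (w \in center A).
Proof.
have -> : (w \in center A) = all (fun H : {vspace V} => w \in H) (enum_fset A).
  rewrite /center; elim: (enum_fset A) => [|H s IH]; first by rewrite big_nil memvf.
  by rewrite big_cons memv_cap IH.
exact: allP.
Qed.

Lemma center_rank A i : arr_rank A = i -> (\dim (center A) + i = \dim {:V})%N.
Proof. by rewrite /arr_rank -/(center A) => <-; rewrite subnKC // dimvS // subvf. Qed.

Lemma mult_sizeD A B m : A `<=` B ->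
  mult_size (B `\` A) m = (mult_size B m - mult_size A m)%N.
Proof.
move=> /fsubsetP sAB; rewrite /mult_size [in RHS](big_fsetID _ (mem A)) /=.
have -> : [fset x in B | x \in A] = A.
  by apply/fsetP => x; rewrite !inE andb_idl // => /sAB.
have -> : [fset x in B | x \notin A] = B `\` A by apply/fsetP => x; rewrite !inE andbC.
by rewrite addnC addnK.
Qed.

End Center.

Section TraceArr.
Variables (K : fieldType) (V : vectType K) (v : V) (H0 : {vspace V}).
Hypotheses (h0 : hyperplane H0) (v0 : v \notin H0).
Implicit Types (U W : {vspace V}) (B : {fset {vspace V}}).

Lemma trace_on_cap U W : trace_on H0 (U :&: W)%VS = (trace_on H0 U :&: trace_on H0 W)%VS.
Proof. by apply/vspaceP => w; rewrite memv_cap !mem_trace_on memv_cap. Qed.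

Lemma trace_on_le U W : v \in U -> v \in W ->
  (trace_on H0 U <= trace_on H0 W)%VS = (U <= W)%VS.
Proof.
move=> vU vW; apply/idP/idP => /subvP sUW; apply/subvP => w; last first.
  by rewrite !mem_trace_on; apply: sUW.
rewrite -[in X in X -> _](lift_trace_on h0 v0 vU) -[in X in _ -> X](lift_trace_on h0 v0 vW).
by have := sUW (pr_along v H0 w); rewrite -!(memv_preim (pr_along v H0)).
Qed.

Lemma trace_on_inj U W : v \in U -> v \in W -> trace_on H0 U = trace_on H0 W -> U = W.
Proof.
by move=> vU vW E; rewrite -(lift_trace_on h0 v0 vU) E lift_trace_on.
Qed.

Lemma mem_trace_arr B U : (forall W, W \in B -> v \in W) -> v \in U ->
  (trace_on H0 U \in trace_arr H0 B) = (U \in B).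
Proof.
move=> hB vU; apply/trace_arrP/idP => [[W WB /trace_on_inj ->]|UB] //; first exact: hB.
by exists U.
Qed.

Lemma trace_arr_sub B B' : B `<=` B' -> trace_arr H0 B `<=` trace_arr H0 B'.
Proof.
move=> /fsubsetP sB; apply/fsubsetP => Y /trace_arrP [U /sB UB ->].
by apply/trace_arrP; exists U.
Qed.

Lemma trace_arrD B B' : (forall W, W \in B -> v \in W) ->
  (forall W, W \in B' -> v \in W) ->
  trace_arr H0 B `\` trace_arr H0 B' = trace_arr H0 (B `\` B').
Proof.
move=> hB hB'; apply/fsetP => Y; rewrite in_fsetD.
apply/andP/trace_arrP => [[nY /trace_arrP [U UB YE]]|[U]].
  by exists U; rewrite // in_fsetD UB andbT -mem_trace_arr ?hB // -YE.
rewrite in_fsetD => /andP [UB' UB] ->; rewrite !mem_trace_arr //; exact: hB.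
Qed.

Lemma sum_trace_arr B m (P : pred {vspace subvs_of H0}) :
  (forall W, W \in B -> v \in W) ->
  (\sum_(Y <- trace_arr H0 B | P Y) lift_mult v m Y =
   \sum_(U <- B | P (trace_on H0 U)) m U)%N.
Proof.
move=> hB; rewrite big_mkcond [RHS]big_mkcond big_imfset /=; last first.
  by move=> U W /hB vU /hB vW; apply: trace_on_inj.
rewrite !big_seq; apply: eq_bigr => U /hB vU.
by rewrite /lift_mult lift_trace_on.
Qed.

(** The center of B contains v, so H0 is transversal to it and codimensions are preserved. *)
Lemma arr_rank_trace B i : (forall W, W \in B -> v \in W) -> arr_rank B = i ->
  arr_rank (trace_arr H0 B) = i.
Proof.
move=> hB /center_rank rB.
have cE : center (trace_arr H0 B) = trace_on H0 (center B).
  apply/vspaceP => w; rewrite mem_trace_on.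
  apply/mem_center/mem_center => h U.
    by move=> UB; rewrite -mem_trace_on; apply: h; apply/trace_arrP; exists U.
  by move=> /trace_arrP [W WB ->]; rewrite mem_trace_on; apply: h.
rewrite /arr_rank -/(center _) cE dim_trace_on dimvf /dim /=.
have vB : v \in center B by apply/mem_center.
have := dimv_sum_cap H0 (center B).
have -> : \dim (H0 + center B) = \dim {:V}.
  apply/eqP; rewrite eqn_leq dimvS ?subvf //= -h0 ltnNge; apply/negP => le.
  have /eqP sE : H0 == (H0 + center B)%VS by rewrite eqEdim addvSl.
  by case/negP: v0; rewrite sE; apply: (subvP (addvSr _ _)).
by move: h0; rewrite /hyperplane; lia.
Qed.

End TraceArr.

Section Filtration.
Variables (K : fieldType) (V : vectType K).
Variables (A : {fset {vspace V}}) (m : {vspace V} -> nat) (r : nat).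
Variable F : nat -> {fset {vspace V}}.

Definition interpolation_bound : Prop := forall d, (3 <= d <= r)%N ->
  forall H' H'', H' \in F d `\` F d.-1 -> H'' \in F d.-1 ->
  localization A (H' :&: H'')%VS = [fset H'; H''] \/
  (\sum_(H <- F d `\` F d.-1 | (H' :&: H'' <= H)%VS) m H - 1 <= m H'')%N.

Hypothesis ssF : supersolvable_filtration A r F.

Lemma filtration_mono i j : (1 <= i)%N -> (i <= j)%N -> (j <= r)%N -> F i `<=` F j.
Proof.
have [_ hS _ _] := ssF; move=> i1 ij; elim: j ij => [|j IH] ij jr.
  by move: i1; rewrite leqNgt; case: i ij.
have [<-|nij] := eqVneq i j.+1; first exact: fsubset_refl.
have ij' : (i <= j)%N by rewrite -ltnS ltn_neqAle nij.
apply: fsubset_trans (IH ij' (ltnW jr)) _.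
by apply: (hS j.+1); rewrite jr ltnS (leq_trans i1).
Qed.

Lemma filtration_pred : (2 <= r)%N -> supersolvable_filtration (F r.-1) r.-1 F.
Proof.
have [_ hS hR hM] := ssF; move=> r2; split=> // i hi; [apply: hS|apply: hR|apply: hM]; lia.
Qed.

(** The rank drops, so some v lies in the center of A_(r-1) but not in that of A. If v were in one H
    of C, then for any other H' of C modularity gives H /\ H' = H /\ U with U in A_(r-1), so v would
    lie in H' too, and thus in every member of A. *)
Lemma filtration_direction : (3 <= r)%N -> multiarrangement A m ->
  interpolation_bound -> exists v, modular_ext v (F r.-1) (A `\` F r.-1) m.
Proof.
have [FrA hS hR hM] := ssF; move=> r3 mA hyp.
have sBA : F r.-1 `<=` A by rewrite -FrA; apply: filtration_mono; lia.
have hA H : H \in A -> hyperplane H by move=> /mA [].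
have hB H : H \in F r.-1 -> hyperplane H by move=> /(fsubsetP sBA) /hA.
have [v vB vA] : exists2 v, v \in center (F r.-1) & v \notin center A.
  have /subvPn [v vB vA] : ~~ (center (F r.-1) <= center A)%VS; last by exists v.
  have rA : arr_rank A = r by rewrite -FrA; apply: hR; lia.
  have rB : arr_rank (F r.-1) = r.-1 by apply: hR; lia.
  apply/negP => /dimvS; have := center_rank rA; have := center_rank rB; lia.
have vU U : U \in F r.-1 -> v \in U by move/mem_center: vB; apply.
have hM' H H' : H \in A `\` F r.-1 -> H' \in A `\` F r.-1 -> H != H' ->
    exists2 U, U \in F r.-1 & (H :&: H' <= U)%VS.
  rewrite !in_fsetD => /andP [_ HA] /andP [_ HA'].
  by apply: hM; rewrite ?FrA //; lia.
exists v; split=> //.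
- by move=> U UB; split; [apply: hB|apply: vU].
- move=> H HC; have := HC; rewrite in_fsetD => /andP [nHB HA]; split; first exact: hA.
  apply: contra vA => vH; apply/mem_center => H' H'A.
  have [H'B|nH'B] := boolP (H' \in F r.-1); first exact: vU.
  have [<- //|nHH] := eqVneq H H'.
  have H'C : H' \in A `\` F r.-1 by rewrite in_fsetD nH'B.
  have [U UB sU] := hM' H H' HC H'C nHH.
  have nU : H != U by apply: contraNneq nHB => ->.
  have := cap_eq (hA H HA) (hA H' H'A) (hB U UB) nHH nU sU.
  by move=> /vspaceP /(_ v); rewrite !memv_cap vH vU.
move=> H U HC UB; have := hyp r _ H U; rewrite FrA; case=> //; first by lia.
  move=> locE; left=> H'; rewrite in_fsetD => /andP [nH'B H'A] sH'.
  have : H' \in localization A (H :&: U)%VS by rewrite !inE H'A.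
  rewrite locE !inE => /orP [/eqP //|/eqP H'U].
  by rewrite H'U UB in nH'B.
by move=> h; right; lia.
Qed.

End Filtration.

Lemma interpolation_bound_pred (K : fieldType) (V : vectType K)
    (A : {fset {vspace V}}) m r F :
  supersolvable_filtration A r F -> (2 <= r)%N -> interpolation_bound A m r F ->
  interpolation_bound (F r.-1) m r.-1 F.
Proof.
move=> ssF r2 hyp d hd H' H'' H'F H''F.
have [|locE|] := hyp d _ H' H'' H'F H''F; [lia|left|by right].
have [FrA _ _ _] := ssF.
have sBA : F r.-1 `<=` A by rewrite -FrA; apply: (filtration_mono ssF); lia.
have H'B : H' \in F r.-1.
  move: H'F; rewrite in_fsetD => /andP [_]; apply/fsubsetP.
  by apply: (filtration_mono ssF); lia.
have H''B : H'' \in F r.-1.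
  by move: H''F; apply/fsubsetP; apply: (filtration_mono ssF); lia.
rewrite -locE; apply/fsetP => H; rewrite !inE; apply/andP/andP => -[HB sH]; split=> //.
  exact: (fsubsetP sBA).
have : H \in localization A (H' :&: H'')%VS by rewrite !inE HB.
by rewrite locE !inE => /orP [] /eqP ->.
Qed.

(** * The filtration induced on a restriction *)

Section TraceFiltration.
Variables (K : fieldType) (V : vectType K) (v : V) (H0 : {vspace V}).
Hypotheses (h0 : hyperplane H0) (v0 : v \notin H0).
Variables (B : {fset {vspace V}}) (m : {vspace V} -> nat) (r : nat).
Variable F : nat -> {fset {vspace V}}.
Hypothesis ssF : supersolvable_filtration B r F.
Hypothesis hB : forall U, U \in B -> hyperplane U /\ v \in U.

Let vF i : (1 <= i <= r)%N -> forall U, U \in F i -> v \in U.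
Proof.
move=> /andP [i1 ir] U UF; have [FB _ _ _] := ssF.
apply: (hB _).2; rewrite -FB; move: UF; apply/fsubsetP.
exact: (filtration_mono ssF).
Qed.

(** Subspaces through v correspond to their traces on H0, compatibly with inclusion, intersection
    and codimension; all conditions on the filtration of B pass through this correspondence. *)
Lemma supersolvable_trace :
  supersolvable_filtration (trace_arr H0 B) r (fun i => trace_arr H0 (F i)).
Proof.
have [FB hS hR hM] := ssF; split.
- by rewrite FB.
- by move=> i hi; apply/trace_arr_sub/hS.
- by move=> i hi; apply: (arr_rank_trace h0 v0); [apply: vF|apply: hR].
move=> i hi Y Y' /trace_arrP [U UF ->] /trace_arrP [U' UF' ->] nYY.
have [|W WF sW] := hM i hi U U' UF UF'; first by apply: contraNneq nYY => ->.
exists (trace_on H0 W); first by apply/trace_arrP; exists W.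
rewrite -trace_on_cap (trace_on_le h0 v0) //.
  by rewrite memv_cap !(vF (i := i)) //; lia.
by apply: (vF (i := i.-1)) => //; lia.
Qed.

Lemma interpolation_bound_trace : interpolation_bound B m r F ->
  interpolation_bound (trace_arr H0 B) (lift_mult v m) r (fun i => trace_arr H0 (F i)).
Proof.
move=> hyp d hd Y' Y''; have d1 : (1 <= d <= r)%N by lia.
have d2 : (1 <= d.-1 <= r)%N by lia.
have sFB i : (1 <= i <= r)%N -> F i `<=` B.
  by have [<- _ _ _] := ssF; move=> hi; apply: (filtration_mono ssF); lia.
rewrite (trace_arrD h0 v0); [|exact: vF|exact: vF].
move=> /trace_arrP [U' U'F ->] /trace_arrP [U'' U''F ->].
have U'Fd : U' \in F d by move: U'F; rewrite in_fsetD => /andP [].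
have vU' := vF d1 U'Fd; have vU'' := vF d2 U''F.
have vX : v \in (U' :&: U'')%VS by rewrite memv_cap vU' vU''.
have leE (W : {vspace V}) : v \in W -> (trace_on H0 U' :&: trace_on H0 U'' <= trace_on H0 W)%VS =
    (U' :&: U'' <= W)%VS.
  by move=> vW; rewrite -trace_on_cap (trace_on_le h0 v0).
have [locE|h] := hyp d hd U' U'' U'F U''F; [left|right].
  apply/fsetP => Y; rewrite !inE; apply/andP/orP => [[/trace_arrP [W WB ->]]|].
    have vW := (hB WB).2; rewrite leE // => sW.
    have : W \in localization B (U' :&: U'')%VS by rewrite !inE WB.
    by rewrite locE !inE => /orP [] /eqP ->; [left|right].
  have U'B := fsubsetP (sFB d d1) _ U'Fd; have U''B := fsubsetP (sFB _ d2) _ U''F.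
  by case=> /eqP ->; split; rewrite ?capvSl ?capvSr //; apply/trace_arrP;
    [exists U'|exists U''].
have vD W : W \in F d `\` F d.-1 -> v \in W.
  by rewrite in_fsetD => /andP [_]; apply: vF.
rewrite (sum_trace_arr h0 v0) // /lift_mult lift_trace_on //.
rewrite big_seq_cond (eq_bigl (fun W => (W \in F d `\` F d.-1) && (U' :&: U'' <= W)%VS)).
  by rewrite -big_seq_cond.
by move=> W; case WF: (W \in _) => //=; apply/leE/vD.
Qed.

End TraceFiltration.

(** Induction on r - 2 for all vector spaces at once, because the induction hypothesis serves both B
    in V and the trace of B in H0. *)
Lemma supersolvable_IFM (K : fieldType) (k : nat) (V : vectType K)
    (A : {fset {vspace V}}) (m : {vspace V} -> nat)
    (F : nat -> {fset {vspace V}}) (d1 d2 : nat) :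
  multiarrangement A m -> supersolvable_filtration A k.+2 F ->
  has_exp (F 2%N) m [:: d1, d2 & nseq (\dim {:V} - 2) 0%N] ->
  interpolation_bound A m k.+2 F ->
  IFM A m /\
  has_exp A m
    ([:: d1, d2 & [seq (mult_size (F i) m - mult_size (F i.-1) m)%N
                  | i <- index_iota 3 k.+3]]
     ++ nseq (\dim {:V} - k.+2) 0%N).
Proof.
elim: k V A m F => [|k IH] V A m F mA ssF exp2 hyp.
  have [F2A _ hR _] := ssF; split; last by rewrite -{1}F2A.
  apply: (@rank2_IFM _ _ (center A)).
  - by have := center_rank (hR 2%N isT); rewrite F2A addn2.
  - move=> H HA; split; first by case: (mA H HA).
    by apply/subvP => w /mem_center; apply.
  by move=> H /mA [].
have [FrA _ hR _] := ssF.
pose B := F k.+2; pose C := A `\` B.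
have [v hE] : exists v, modular_ext v B C m.
  exact: (filtration_direction ssF isT mA hyp).
have [hB hC _ _] := hE.
have sBA : B `<=` A by rewrite -FrA; apply: (filtration_mono ssF).
have hA H : H \in A -> hyperplane H by move=> /mA [].
have BC : B `|` C = A.
  apply/fsetP => H; rewrite in_fsetU in_fsetD; case HB : (H \in B) => //=.
  by rewrite (fsubsetP sBA).
have ssB : supersolvable_filtration B k.+2 F by apply: (filtration_pred ssF).
have hypB := interpolation_bound_pred ssF isT hyp.
have mB : multiarrangement B m by move=> H /(fsubsetP sBA) /mA.
have [IB expB] := IH V B m F mB ssB exp2 hypB.
have dimA : (\dim (center A) + k.+3 = \dim {:V})%N.
  by rewrite -FrA; apply/center_rank/hR; rewrite leqnn.
(* The rank bounds dim V from below, so the subtractions are exact and exp(B, m) has one zero more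
   than is wanted: the degree of d/dv. *)
have dimk : (\dim {:V} - k.+2 = (\dim {:V} - k.+3).+1)%N by lia.
(* The rank grows, so C has a member; it does not contain v, whence v is nonzero, as the exchange
   requires. *)
have [H1 H1C] : exists H1, H1 \in C.
  have [C0|[H1]] := fset_0Vmem C; last by exists H1.
  have AB : A = B by rewrite -BC C0 fsetU0.
  have := hR k.+2; have := hR k.+3; rewrite FrA AB -/B => -> //; first by lia.
  by rewrite leqnn.
have v0 : v != 0 by apply: contraNneq (hC H1 H1C).2 => ->; apply: mem0v.
pose ds := [seq (mult_size (F i) m - mult_size (F i.-1) m)%N | i <- index_iota 3 k.+3].
pose E := [:: d1, d2 & ds] ++ nseq (\dim {:V} - k.+3) 0%N.
have sds : size ds = k by rewrite size_map size_iota; lia.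
have sE : (size E).+1 = \dim {:V}.
  by rewrite /E /= size_cat size_nseq sds; lia.
have [z zE hz] := has_exp_hspan expB.
have [z' pz hz'] := hspan_exchange hB v0 hz.
have pE : perm_eq (unzip1 z') E.
  rewrite -(perm_cons 0%N) -(permPl pz) zE dimk /E -/ds.
  exact: permEl (perm_catCA [:: d1, d2 & ds] [:: 0%N] _).
have sz' : (size z').+1 = \dim {:V}.
  by rewrite -sE -(perm_size pE) size_map.
have [z2 z2E hz2] := hspan_modular_ext hE hz'.
rewrite BC in hz2.
have sz2 : size z2 = \dim {:V}.
  by rewrite -sz' -(size_map fst z2) -/(unzip1 z2) z2E /= size_map.
split; last first.
  apply: (has_exp_perm hA _ _ (hspan_has_exp hA sz2 hz2)); first by rewrite size_map.
  rewrite z2E mult_sizeD // -FrA.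
  rewrite (perm_trans (y := (mult_size (F k.+3) m - mult_size B m)%N :: E)) ?perm_cons //.
  have -> : index_iota 3 k.+4 = rcons (index_iota 3 k.+3) k.+3.
    by rewrite /index_iota !subSS !subn0 -cats1 -(addn1 k) iotaD addn1.
  rewrite map_rcons -/ds /E -cats1 /= -!cat_cons -catA.
  exact: permEl (perm_catCA [:: _] [:: d1, d2 & ds] _).
rewrite -BC; apply: (IFM_modular_ext sz' hE) => //.
  by move=> H; rewrite BC => /mA [].
move=> H0 H0C; have [h0 vH0] := hC H0 H0C.
have dH0 : \dim {:subvs_of H0} = (\dim {:V}).-1 by rewrite dimvf /dim /= -h0.
have vF2 U : U \in F 2%N -> hyperplane U /\ v \in U.
  by move=> UF; apply: hB; move: UF; apply/fsubsetP/(filtration_mono ssF).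
have [||||//] := IH _ (trace_arr H0 B) (lift_mult v m) (fun i => trace_arr H0 (F i)).
- move=> Y /trace_arrP [U UB ->]; have [hU vU] := hB U UB; split.
    by apply: hyperplane_trace_on => //; apply: contraNneq vH0 => ->.
  by rewrite /lift_mult lift_trace_on //; case: (mB U UB).
- exact: (supersolvable_trace h0 vH0 ssB hB).
(* All members of A_2 contain v, so d/dv takes up one of the zeros and the trace of A_2 keeps d1,
   d2. *)
- have [y yE hy] := has_exp_hspan exp2.
  have [y' py hy'] := hspan_exchange vF2 v0 hy.
  have [w wE hw] := hspan_trace_arr h0 vH0 vF2 hy'.
  have pw : perm_eq (unzip1 w) [:: d1, d2 & nseq (\dim {:subvs_of H0} - 2) 0%N].
    rewrite wE -(perm_cons 0%N) -(permPl py) yE dH0.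
    have -> : (\dim {:V} - 2 = ((\dim {:V}).-1 - 2).+1)%N by lia.
    exact: permEl (perm_catCA [:: d1; d2] [:: 0%N] _).
  have hT : forall Y, Y \in trace_arr H0 (F 2%N) -> hyperplane Y.
    move=> Y /trace_arrP [U UF ->]; have [hU vU] := vF2 U UF.
    by apply: hyperplane_trace_on => //; apply: contraNneq vH0 => ->.
  have sw : size w = \dim {:subvs_of H0}.
    rewrite -(size_map fst w) -/(unzip1 w) (perm_size pw) /= size_nseq dH0; lia.
  by apply: (has_exp_perm hT _ pw (hspan_has_exp hT sw hw)); rewrite size_map.
exact: (interpolation_bound_trace h0 vH0 ssB hB).
Qed.

Local Close Scope ring_scope.

Theorem theorem5p10 (K : fieldType) (V : vectType K)
    (A : {fset {vspace V}}) (m : {vspace V} -> nat)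
    (r : nat) (F : nat -> {fset {vspace V}}) (d1 d2 : nat)
    (mA : multiarrangement A m)
    (r_ge2 : (2 <= r)%N)
    (ssF : supersolvable_filtration A r F)
    (exp2 : has_exp (F 2) m [:: d1, d2 & nseq (\dim {:V} - 2) 0%N])
    (hyp : forall d, (3 <= d <= r)%N ->
       forall H' H'', H' \in F d `\` F d.-1 -> H'' \in F d.-1 ->
       let X := (H' :&: H'')%VS in
       localization A X = [fset H'; H''] \/
       (\sum_(H <- F d `\` F d.-1 | (X <= H)%VS) m H - 1 <= m H'')%N) :
  IFM A m /\
  has_exp A m
    ([:: d1, d2 & [seq (mult_size (F i) m - mult_size (F i.-1) m)%N
                  | i <- index_iota 3 r.+1]]
     ++ nseq (\dim {:V} - r) 0%N).
Proof.
case: r r_ge2 ssF hyp => [|[|k]] // _ ssF hyp.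
exact: supersolvable_IFM.
Qed.
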